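(* Let $q\in(0,1)$, $\alpha\in(-1,1)$, $\beta<1$ real, and write $p_n=p_n^{(\alpha,\beta)}(\cdot;q)$. Then for all $m,n\in\mathbb{N}_0$, \begin{align*} &\frac{2}{\pi}\int_0^{\pi}p_m(2\cos\theta)p_n(2\cos\theta)\sin^2(\theta)\left|{}_2\phi_1\!\left(e^{{\rm i}\theta}\tau,e^{{\rm i}\theta}\tau^{-1};qe^{2{\rm i}\theta};q,\alpha\right)\right|^{-2}{\rm d}\theta\\ &\quad+\sum_{0<z_k<1}\frac{z_k^2-1}{z_k^2}\frac{\psi_0^+(z_k)}{(\psi_{-1}^+)'(z_k)}\Bigl[p_m(v_k)p_n(v_k)+p_m(-v_k)p_n(-v_k)\Bigr]=\frac{(\alpha;q)_n(\alpha;q)_{n+1}}{(\beta;q)_n(\beta;q)_{n+1}}\delta_{m,n}, \end{align*} where $v_k:=z_k+z_k^{-1}$, $z_k$ runs over the zeros of $\psi_{-1}^+$ in $(0,1)$, and in the integral $\tau$ is related to $\theta$ by $\alpha(\tau+\tau^{-1})=2\beta\cos\theta$. (The sum may be empty.)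
   Context: $(a;q)_n:=\prod_{j=0}^{n-1}(1-aq^j)$, $n\in\mathbb{N}_0\cup\{\infty\}$. The monic polynomials $p_n$ satisfy $p_{-1}=0$, $p_0=1$, $p_{n+1}(x)=xp_n(x)-\tilde\gamma_{n-1}\tilde\gamma_np_{n-1}(x)$ with $\tilde\gamma_n=(1-\alpha q^n)/(1-\beta q^n)$. ${}_2\phi_1(a,b;c;q,w)=\sum_{k\ge0}\frac{(a,b;q)_k}{(c,q;q)_k}w^k$, where $\alpha^k(z\tau,z\tau^{-1};q)_k$ is understood as $c_k(z)=\prod_{j=0}^{k-1}(\alpha(1+z^2q^{2j})-\beta q^j(1+z^2))$ (so only $\alpha(\tau+\tau^{-1})=\beta(z+z^{-1})$ matters, also for $\alpha=0$). For $z\ne0$ and $n\ge-1$, $\psi_n^+(z):=z^n\sum_{k\ge0}\frac{(q^{k+1}z^2;q)_\infty}{(q;q)_k}c_k(z)q^{(n+1)k}$, an analytic function of $z\neq0$. *)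

(* Defs.v *)
From HB Require Import structures.
From mathcomp Require Import all_boot all_order all_algebra.
From mathcomp Require Import all_classical all_reals all_analysis.
From mathcomp.real_closed Require Import complex.

Set Implicit Arguments.
Unset Strict Implicit.
Unset Printing Implicit Defensive.

Import Order.TTheory GRing.Theory Num.Theory.
Import numFieldNormedType.Exports.
Local Open Scope ring_scope.

Definition qpoch {K : comNzRingType} (a q : K) (n : nat) : K :=
  \prod_(j < n) (1 - a * q ^+ j).

Definition qpoch_inf {R : realType} (a q : R) : R :=
  limn ((fun n => qpoch a q n) : R^nat).

Definition gtil {R : realType} (alpha beta q : R) (n : nat) : R :=
  (1 - alpha * q ^+ n) / (1 - beta * q ^+ n).

(* pq n = (p_n, p_{n+1}), where p_{-1} = 0, p_0 = 1 and
   p_{n+1} = x p_n - gtil_{n-1} gtil_n p_{n-1}.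
   (For n = 0 the correction term vanishes since p_{-1} = 0, so p_1 = x.) *)
Fixpoint pq {R : realType} (alpha beta q : R) (n : nat) : {poly R} * {poly R} :=
  match n with
  | 0 => (1, 'X)
  | n'.+1 =>
      let: (a, b) := pq alpha beta q n' in
      (b, 'X * b - (gtil alpha beta q n' * gtil alpha beta q n'.+1)%:P * a)
  end.

Definition pAB {R : realType} (alpha beta q : R) (n : nat) : {poly R} :=
  (pq alpha beta q n).1.

(* c_k(z) = prod_{j<k} (alpha (1 + z^2 q^{2j}) - beta q^j (1 + z^2)),
   i.e. alpha^k (z tau, z tau^{-1}; q)_k with alpha (tau + 1/tau) = beta (z + 1/z) *)
Definition ck {K : comNzRingType} (alpha beta q z : K) (k : nat) : K :=
  \prod_(j < k) (alpha * (1 + z ^+ 2 * q ^+ (2 * j))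
                 - beta * q ^+ j * (1 + z ^+ 2)).

Definition cseries {R : realType} (u : nat -> R[i]) : R[i] :=
  Complex (limn (fun N => complex.Re (\sum_(k < N) u k)))
          (limn (fun N => complex.Im (\sum_(k < N) u k))).

(* 2phi1(e^{i th} tau, e^{i th}/tau; q e^{2 i th}; q, alpha)
   = sum_k c_k(e^{i th}) / ((q e^{2 i th};q)_k (q;q)_k) *)
Definition phi21 {R : realType} (alpha beta q theta : R) : R[i] :=
  let z : R[i] := Complex (cos theta) (sin theta) in
  cseries (fun k => ck ((alpha%:C)%C) ((beta%:C)%C) ((q%:C)%C) z k
                    / (qpoch ((q%:C)%C * z ^+ 2) ((q%:C)%C) k * qpoch ((q%:C)%C) ((q%:C)%C) k)).

Definition csqabs {R : realType} (w : R[i]) : R := complex.Re w ^+ 2 + complex.Im w ^+ 2.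

(* psi_n^+(z) = z^n sum_k (q^{k+1} z^2; q)_oo / (q;q)_k c_k(z) q^{(n+1)k},
   restricted to real z <> 0, for integer n >= -1 *)
Definition psiplus {R : realType} (alpha beta q : R) (n : int) (z : R) : R :=
  z ^ n * limn ((fun N => \sum_(k < N)
     (qpoch_inf (q ^+ k.+1 * z ^+ 2) q / qpoch q q k
      * ck alpha beta q z k * q ^ ((n + 1) * k%:Z))) : R^nat).

(* Main.v *)
(* With w = z^2 one has psi_n(z) = z^n T_(n+1)(w), where the T_N are entire in w and satisfy
   T_N + w T_(N+2) = (1 + w) T_(N+1) / gtil_N; as N grows T_N tends to (q w; q)_oo, and
   2phi1 = T_0 / (q w; q)_oo on the circle |w| = 1. Wronskian monotonicity shows that the
   zeros of T_0 in the closed disc are simple and lie in (0, 1]; dividing them out bounds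
   their number. On the circle the Wronskian gives
     p_n(2 cos th) sin^2 th / |2phi1|^2
       = (prod_(j < n) gtil_j) / 2 * Re (z^n (1 - w) T_(n+1) / T_0),
   and the integral of the right-hand side is computed by residues at the zeros of T_0. The
   residue theorem needed here is elementary: functions of the disc algebra satisfy the mean
   value property, and a pole a in (0, 1) is handled by partial fractions together with
   w / (w - a) = conj (1 / (1 - a w)) on |w| = 1. Hence the functional L of the theorem
   satisfies L(p_n) = 0 for n > 0 and L(1) = gtil_0, and orthogonality follows from the
   three-term recurrence. *)

Require Import Defs.
From HB Require Import structures.
From mathcomp Require Import all_boot all_order all_algebra.
From mathcomp Require Import all_classical all_reals all_analysis.
From mathcomp.real_closed Require Import complex.
From mathcomp Require Import zify ring lra.

Set Implicit Arguments.
Unset Strict Implicit.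
Unset Printing Implicit Defensive.

Import Order.TTheory GRing.Theory Num.Theory.
Import numFieldNormedType.Exports.
Local Open Scope classical_set_scope.
Local Open Scope ring_scope.
Local Open Scope complex_scope.

(** * Complex numbers and geometric series *)

(** No theory of holomorphic functions is used. All functions are power series in w with real
    coefficients of size O(4^-j), so everything converges uniformly on the closed unit disc, and
    division by a zero is synthetic division of coefficient sequences. Real coefficients give
    symmetry under conjugation, which is why real parts over the half circle suffice. Two obstacles
    shape the details. First, T_0 may vanish at w = 1, that is, at both endpoints of the integral;
    the factor 1 - w cancels this simple zero, and the weight is replaced by a continuous function
    that agrees with it on the open interval only. Second, powers of z = e^(i theta) of either
    parity occur while the poles live in w = z^2; each zero a of T_0 therefore contributes at both
    of its square roots, which produces the two masses at v_k and - v_k. *)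

Section ComplexModulus.
Variable R : realType.
Implicit Types (x y z w : R[i]) (a b : R).

(** The norm on [R[i]] takes its values in [R[i]]; its real part gives a modulus in [R], where order
    and limits are at hand. *)
Definition cmod x : R := complex.Re `|x|.

Lemma cmodE x : `|x| = (cmod x)%:C.
Proof. by rewrite /cmod normc_def. Qed.

Lemma cmod_ge0 x : 0 <= cmod x.
Proof. by rewrite -lecR -cmodE; exact: normr_ge0. Qed.

Lemma cmodM x y : cmod (x * y) = cmod x * cmod y.
Proof. by apply: complexI; rewrite rmorphM /= -!cmodE normrM. Qed.

Lemma cmodD x y : cmod (x + y) <= cmod x + cmod y.
Proof. by rewrite -lecR rmorphD /= -!cmodE ler_normD. Qed.

Lemma cmodN x : cmod (- x) = cmod x.
Proof. by apply: complexI; rewrite -!cmodE normrN. Qed.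

Lemma cmodB x y : cmod (x - y) = cmod (y - x).
Proof. by rewrite -cmodN opprB. Qed.

Lemma cmod_tri x y z : cmod (x - z) <= cmod (x - y) + cmod (y - z).
Proof. by rewrite -[x - z](subrKA y) cmodD. Qed.

Lemma cmod0 : cmod 0 = 0.
Proof. by apply: complexI; rewrite -!cmodE normr0. Qed.

Lemma cmod1 : cmod 1 = 1.
Proof. by apply: complexI; rewrite -!cmodE normr1. Qed.

Lemma cmod_eq0 x : (cmod x == 0) = (x == 0).
Proof. by rewrite -(inj_eq (@complexI R)) -cmodE normr_eq0. Qed.

Lemma cmod_gt0 x : (0 < cmod x) = (x != 0).
Proof. by rewrite lt_neqAle cmod_ge0 andbT eq_sym cmod_eq0. Qed.

Lemma cmodV x : cmod x^-1 = (cmod x)^-1.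
Proof. by apply: complexI; rewrite fmorphV /= -!cmodE normfV. Qed.

Lemma cmodX x n : cmod (x ^+ n) = cmod x ^+ n.
Proof. by apply: complexI; rewrite rmorphXn /= -!cmodE normrX. Qed.

Lemma cmodR a : cmod a%:C = `|a|.
Proof.
by apply: complexI; rewrite -cmodE normc_def /= expr0n addr0 sqrtr_sqr.
Qed.

Lemma cmod_conj x : cmod x^* = cmod x.
Proof. by apply: complexI; rewrite -!cmodE normcJ. Qed.

Lemma cmod_sq x : cmod x ^+ 2 = csqabs x.
Proof.
apply: complexI; rewrite rmorphXn /= -cmodE.
by rewrite /csqabs add_Re2_Im2.
Qed.

Lemma Re_le_cmod x : `|complex.Re x| <= cmod x.
Proof. by rewrite -lecR -cmodE normc_ge_Re. Qed.

Lemma Im_le_cmod x : `|complex.Im x| <= cmod x.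
Proof.
rewrite -ler_sqr ?nnegrE ?cmod_ge0 ?normr_ge0 // cmod_sq /csqabs real_normK ?num_real //.
by rewrite lerDr sqr_ge0.
Qed.

Lemma cmod_le_ReIm x : cmod x <= `|complex.Re x| + `|complex.Im x|.
Proof.
rewrite -ler_sqr ?nnegrE ?cmod_ge0 ?addr_ge0 ?normr_ge0 // cmod_sq /csqabs.
rewrite sqrrD !real_normK ?num_real //.
have : 0 <= `|complex.Re x| * `|complex.Im x| by rewrite mulr_ge0.
lra.
Qed.

Lemma cmod_sum (I : Type) (r : seq I) (P : pred I) (F : I -> R[i]) :
  cmod (\sum_(i <- r | P i) F i) <= \sum_(i <- r | P i) cmod (F i).
Proof.
elim/big_ind2: _ => [|x1 y1 x2 y2 h1 h2|//]; first by rewrite cmod0.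
exact: le_trans (cmodD _ _) (lerD h1 h2).
Qed.

Lemma cmod_dist x y : `|cmod x - cmod y| <= cmod (x - y).
Proof.
rewrite ler_norml; have := cmodD (x - y) y; have := cmodD (y - x) x.
rewrite !subrK (cmodB y); lra.
Qed.

Lemma ReD x y : complex.Re (x + y) = complex.Re x + complex.Re y.
Proof. by case: x; case: y. Qed.
Lemma ImD x y : complex.Im (x + y) = complex.Im x + complex.Im y.
Proof. by case: x; case: y. Qed.
Lemma ReN x : complex.Re (- x) = - complex.Re x.
Proof. by case: x. Qed.
Lemma ImN x : complex.Im (- x) = - complex.Im x.
Proof. by case: x. Qed.
Lemma ReM x y :
  complex.Re (x * y) = complex.Re x * complex.Re y - complex.Im x * complex.Im y.
Proof. by case: x; case: y. Qed.
Lemma ImM x y :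
  complex.Im (x * y) = complex.Re x * complex.Im y + complex.Im x * complex.Re y.
Proof. by case: x; case: y. Qed.
Lemma Re_scale a x : complex.Re (a%:C * x) = a * complex.Re x.
Proof. by case: x => u v /=; rewrite mul0r subr0. Qed.
Lemma Im_scale a x : complex.Im (a%:C * x) = a * complex.Im x.
Proof. by case: x => u v /=; rewrite mul0r addr0. Qed.
Lemma conjcM x y : conjc (x * y) = conjc x * conjc y.
Proof. exact: rmorphM. Qed.
Lemma ReJ x : complex.Re x^* = complex.Re x.
Proof. by case: x. Qed.
Lemma ImJ x : complex.Im x^* = - complex.Im x.
Proof. by case: x. Qed.
Lemma Re_sum (I : Type) (r : seq I) (P : pred I) (F : I -> R[i]) :
  complex.Re (\sum_(i <- r | P i) F i) = \sum_(i <- r | P i) complex.Re (F i).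
Proof. by elim/big_rec2: _ => [//|i a b _ <-]; rewrite ReD. Qed.
Lemma Im_sum (I : Type) (r : seq I) (P : pred I) (F : I -> R[i]) :
  complex.Im (\sum_(i <- r | P i) F i) = \sum_(i <- r | P i) complex.Im (F i).
Proof. by elim/big_rec2: _ => [//|i a b _ <-]; rewrite ImD. Qed.

Lemma complex_ext x y :
  complex.Re x = complex.Re y -> complex.Im x = complex.Im y -> x = y.
Proof. by case: x; case: y => a b c d /= -> ->. Qed.

Lemma csqabs0 x : (csqabs x == 0) = (x == 0).
Proof. by rewrite -cmod_sq sqrf_eq0 cmod_eq0. Qed.

Lemma ReV x : complex.Re x^-1 = complex.Re x / csqabs x.
Proof. by case: x. Qed.

Lemma ImV x : complex.Im x^-1 = - complex.Im x / csqabs x.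
Proof. by case: x => a b /=; rewrite /csqabs /= mulNr. Qed.

Lemma csqabsM x y : csqabs (x * y) = csqabs x * csqabs y.
Proof. by rewrite -!cmod_sq cmodM exprMn. Qed.

Lemma csqabsV x : csqabs x^-1 = (csqabs x)^-1.
Proof. by rewrite -!cmod_sq cmodV exprVn. Qed.

Lemma invcE x : x^-1 = ((csqabs x)^-1)%:C * conjc x.
Proof.
apply: complex_ext; rewrite ?Re_scale ?Im_scale ?ReV ?ImV ?ReJ ?ImJ mulrC //.
Qed.

End ComplexModulus.

Section GeometricSeries.
Variable R : realType.

Lemma geo_sum_le (s : R) (m n : nat) : 0 <= s < 1 ->
  \sum_(m <= k < n) s ^+ k <= s ^+ m / (1 - s).
Proof.
move=> /andP[s0 s1]; have d0 : 0 < 1 - s by rewrite subr_gt0.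
rewrite ler_pdivlMr //.
have [nm|mn] := leqP n m; first by rewrite big_geq // mul0r exprn_ge0.
suff -> : (\sum_(m <= k < n) s ^+ k) * (1 - s) = s ^+ m - s ^+ n.
  by rewrite gerBl exprn_ge0.
rewrite mulr_suml (eq_bigr (fun k => - (s ^+ k.+1 - s ^+ k))); last first.
  by move=> k _; rewrite exprS; ring.
by rewrite sumrN telescope_sumr ?(ltnW mn) // opprB.
Qed.

Lemma small_geo (s M e : R) : 0 <= s < 1 -> 0 < e ->
  exists N, forall n, (N <= n)%N -> M * s ^+ n <= e.
Proof.
move=> /andP[s0 s1] e0.
have /cvgrPdist_lt /(_ e e0) [N _ hN] :
    @geometric R M s @ \oo --> (0 : R) by apply: cvg_geometric; rewrite ger0_norm.
exists N => n Nn; move: (hN n Nn); rewrite /= sub0r normrN => h.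
exact: le_trans (ler_norm _) (ltW h).
Qed.

Lemma le_geo_eq0 (s M x : R) : 0 <= s < 1 -> 0 <= x ->
  (forall n, x <= M * s ^+ n) -> x = 0.
Proof.
move=> s01 x0 h; apply/eqP; rewrite eq_le x0 andbT leNgt; apply/negP => xp.
have /(small_geo M s01) [N hN] : 0 < x / 2 by rewrite divr_gt0.
by have := le_trans (h N) (hN N (leqnn _)); lra.
Qed.

Variable (s M : R).
Hypothesis s01 : 0 <= s < 1.

Lemma geo_bound_ge0 (T : Type) (f : T -> R) (u : nat -> T) :
  (forall x, 0 <= f x) -> (forall k, f (u k) <= M * s ^+ k) -> 0 <= M.
Proof. by move=> f0 /(_ 0%N); rewrite expr0 mulr1; apply: le_trans. Qed.

Lemma geo_partial (u : nat -> R) : (forall k, `|u k| <= M * s ^+ k) ->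
  forall m n : nat, (m <= n)%N ->
  `|\sum_(k < n) u k - \sum_(k < m) u k| <= M * (s ^+ m / (1 - s)).
Proof.
move=> hu m n mn.
have M0 : 0 <= M by apply: (geo_bound_ge0 (f := Num.norm)) hu.
rewrite -!(big_mkord predT) (big_cat_nat (leq0n m) mn) //= [X in X - _]addrC addrK.
apply: le_trans (ler_norm_sum _ _ _) _.
apply: le_trans (ler_sum _ (fun k _ => hu k)) _.
by rewrite -mulr_sumr ler_wpM2l // geo_sum_le.
Qed.

Lemma geo_cvg (u : nat -> R) : (forall k, `|u k| <= M * s ^+ k) ->
  cvgn ((fun n => \sum_(k < n) u k) : R^nat).
Proof.
move=> hu; have := s01 => /andP[s0 s1].
have M0 : 0 <= M by apply: (geo_bound_ge0 (f := Num.norm)) hu.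
have : cvgn (series (fun k => `|u k|)).
  apply: (@series_le_cvg _ _ (fun k => M * s ^+ k)) => //.
  - by move=> n; rewrite mulr_ge0 ?exprn_ge0.
  - by apply: is_cvg_geometric_series; rewrite ger0_norm.
suff -> : (fun n => \sum_(k < n) u k) = series u by exact: normed_cvg.
by apply/funext => n; rewrite /series /= big_mkord.
Qed.

Lemma geo_tail (u : nat -> R) : (forall k, `|u k| <= M * s ^+ k) ->
  forall m : nat, `|limn (fun n => \sum_(k < n) u k) - \sum_(k < m) u k|
    <= M * (s ^+ m / (1 - s)).
Proof.
move=> hu m.
have h : (fun n => `|\sum_(k < n) u k - \sum_(k < m) u k|) @ \oo -->
   `|limn (fun n => \sum_(k < n) u k) - \sum_(k < m) u k|.
  apply: cvg_norm; apply: cvgB; last exact: cvg_cst.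
  exact: geo_cvg hu.
apply: (cvgr_to_le h); exists m => // n /= mn; exact: geo_partial.
Qed.

End GeometricSeries.

(** * Power series *)

Section ComplexSeries.
Variable R : realType.
Implicit Types (u v : nat -> R[i]) (x y w : R[i]) (a b : nat -> R).

(** Convergence phrased through the real modulus, so that complex series can be manipulated without
    a topology on [R[i]]; [cseries_eq] converts it into the componentwise limits that define
    [cseries]. *)
Definition csum_to u x :=
  forall e : R, 0 < e -> exists N, forall n, (N <= n)%N ->
    cmod (x - \sum_(k < n) u k) <= e.

Definition geo_summable u := exists M s : R, 0 <= s < 1 /\ forall k, cmod (u k) <= M * s ^+ k.

(** The factor 2 appears because real and imaginary parts are estimated separately. *)
Lemma cseries_tail u (M s : R) : 0 <= s < 1 ->
  (forall k, cmod (u k) <= M * s ^+ k) ->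
  forall m, cmod (cseries u - \sum_(k < m) u k) <= 2 * (M * (s ^+ m / (1 - s))).
Proof.
move=> s01 hu m; apply: le_trans (cmod_le_ReIm _) _.
rewrite !ReD !ImD !ReN !ImN /= !Re_sum !Im_sum mulrDl !mul1r.
have eR : (fun n => complex.Re (\sum_(k < n) u k)) =
    fun n => \sum_(k < n) complex.Re (u k) by apply/funext => n; rewrite Re_sum.
have eI : (fun n => complex.Im (\sum_(k < n) u k)) =
    fun n => \sum_(k < n) complex.Im (u k) by apply/funext => n; rewrite Im_sum.
rewrite eR eI; apply: lerD.
- apply: (@geo_tail _ s M s01 (fun k => complex.Re (u k))) => k.
  exact: le_trans (Re_le_cmod _) (hu k).
- apply: (@geo_tail _ s M s01 (fun k => complex.Im (u k))) => k.
  exact: le_trans (Im_le_cmod _) (hu k).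
Qed.

Lemma csum_to_unique u x y : csum_to u x -> csum_to u y -> x = y.
Proof.
move=> hx hy; apply/eqP; rewrite -subr_eq0 -cmod_eq0 eq_le cmod_ge0 andbT.
apply/ler_addgt0Pl => e e0; rewrite addr0.
have [|N1 h1] := hx (e / 2); first by rewrite divr_gt0.
have [|N2 h2] := hy (e / 2); first by rewrite divr_gt0.
apply: le_trans (cmod_tri _ (\sum_(k < maxn N1 N2) u k) _) _.
rewrite [cmod (_ - y)]cmodB (splitr e) lerD // ?h1 ?h2 //.
- exact: leq_maxl.
- exact: leq_maxr.
Qed.

Lemma geo_csum_to u : geo_summable u -> csum_to u (cseries u).
Proof.
move=> [M [s [s01 hu]]] e e0.
have [N hN] := small_geo (2 * (M / (1 - s))) s01 e0.
exists N => n Nn; apply: le_trans (cseries_tail s01 hu n) _.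
by apply: le_trans (hN n Nn); rewrite le_eqVlt; apply/orP; left; apply/eqP; ring.
Qed.

Lemma cseries_eq u x : csum_to u x -> cseries u = x.
Proof.
move=> hx; apply: complex_ext => /=; apply: cvg_lim => //; apply/cvgrPdist_le => e e0;
  have [N hN] := hx e e0; exists N => // n /= Nn; apply: le_trans (hN n Nn).
- by rewrite -ReN -ReD Re_le_cmod.
- by rewrite -ImN -ImD Im_le_cmod.
Qed.

Lemma csum_toD u v x y : csum_to u x -> csum_to v y ->
  csum_to (fun k => u k + v k) (x + y).
Proof.
move=> hx hy e e0.
have [|N1 h1] := hx (e / 2); first by rewrite divr_gt0.
have [|N2 h2] := hy (e / 2); first by rewrite divr_gt0.
exists (maxn N1 N2) => n; rewrite geq_max => /andP[n1 n2].
rewrite big_split /= opprD addrACA.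
by apply: le_trans (cmodD _ _) _; rewrite (splitr e) lerD // ?h1 ?h2.
Qed.

Lemma csum_toZ u x c : csum_to u x -> csum_to (fun k => c * u k) (c * x).
Proof.
move=> hx e e0; have c0 : 0 < cmod c + 1 by rewrite ltr_wpDl ?cmod_ge0.
have [|N h] := hx (e / (cmod c + 1)); first by rewrite divr_gt0.
exists N => n /h hn; rewrite -mulr_sumr -mulrBr cmodM.
apply: le_trans (_ : (cmod c + 1) * (e / (cmod c + 1)) <= e).
  by rewrite ler_pM ?cmod_ge0 // lerDl.
by rewrite mulrC divfK // gt_eqF.
Qed.

Lemma csum_toS u x : csum_to (fun k => u k.+1) x -> csum_to u (u 0%N + x).
Proof.
move=> hx e e0; have [N h] := hx e e0; exists N.+1 => -[//|n] /h.
by rewrite big_ord_recl [in X in X -> _]/= opprD addrACA subrr add0r.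
Qed.

Lemma csum_to_bound u x (B : R) : csum_to u x ->
  (forall n, cmod (\sum_(k < n) u k) <= B) -> cmod x <= B.
Proof.
move=> hx hB; apply/ler_addgt0Pl => e /hx [N hN].
rewrite -[x](subrK (\sum_(k < N) u k)).
by apply: le_trans (cmodD _ _) (lerD (hN N (leqnn _)) (hB N)).
Qed.

Lemma eq_csum_to u v x : u =1 v -> csum_to u x -> csum_to v x.
Proof. by move=> /funext ->. Qed.

Lemma cseries_real (r : nat -> R) :
  cseries (fun k => (r k)%:C) = (complex.Re (cseries (fun k => (r k)%:C)))%:C.
Proof.
apply: complex_ext => //=; apply: cvg_lim => //.
rewrite (_ : (fun _ => _) = fun=> 0); first exact: cvg_cst.
by apply/funext => n; rewrite Im_sum big1.
Qed.

Lemma Re_cseries_real (r : nat -> R) :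
  complex.Re (cseries (fun k => (r k)%:C)) = limn (fun n => \sum_(k < n) r k).
Proof.
by rewrite /=; congr (limn _); apply/funext => n; rewrite Re_sum.
Qed.

End ComplexSeries.

Section PowerSeries.
Variable R : realType.
Implicit Types (x y w z : R[i]) (a b : nat -> R) (r M : R).

Definition cev a w := cseries (fun j => (a j)%:C * w ^+ j).

(** The working rate is r = 1/4: it survives multiplication by linear factors and deflation, and
    differentiation degrades it only to 1/2, the rate of [geo], since j <= 2 ^ j. *)
Definition gb r M a := forall j, `|a j| <= M * r ^+ j.

Definition geo a := exists M, gb (1 / 2) M a.

Lemma half01 : 0 <= (1 / 2 : R) < 1.
Proof. by lra. Qed.

Lemma quarter01 : 0 <= (1 / 4 : R) < 1.
Proof. by lra. Qed.

Lemma gb_ge0 r M a : gb r M a -> 0 <= M.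
Proof. by move=> /(_ 0%N); rewrite expr0 mulr1; apply: le_trans. Qed.

Lemma gb_quarter_geo M a : gb (1 / 4) M a -> geo a.
Proof.
move=> h; exists M => j; apply: le_trans (h j) _; rewrite ler_wpM2l ?(gb_ge0 h) //.
by rewrite lerXn2r ?nnegrE //; lra.
Qed.

Lemma cev_terms r M a w : gb r M a -> cmod w <= 1 ->
  forall j, cmod ((a j)%:C * w ^+ j) <= M * r ^+ j.
Proof.
move=> h w1 j; rewrite cmodM cmodR cmodX; apply: le_trans (h j).
by rewrite ler_piMr // exprn_ile1 // cmod_ge0.
Qed.

Lemma cev_tail r M a w : 0 <= r < 1 -> gb r M a -> cmod w <= 1 ->
  forall m, cmod (cev a w - \sum_(j < m) (a j)%:C * w ^+ j)
    <= 2 * (M * (r ^+ m / (1 - r))).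
Proof. by move=> r01 h w1; apply: cseries_tail => //; exact: cev_terms. Qed.

Lemma cev_bound r M a w : 0 <= r < 1 -> gb r M a -> cmod w <= 1 ->
  cmod (cev a w) <= 2 * (M / (1 - r)).
Proof.
move=> r01 h w1; have := cev_tail r01 h w1 0.
by rewrite big_ord0 subr0 expr0 div1r.
Qed.

Lemma cev_sum a w : geo a -> cmod w <= 1 ->
  csum_to (fun j => (a j)%:C * w ^+ j) (cev a w).
Proof.
move=> [M h] w1; apply: geo_csum_to; exists M, (1 / 2); split; first exact: half01.
exact: cev_terms.
Qed.

Lemma geoD a b : geo a -> geo b -> geo (fun j => a j + b j).
Proof.
move=> [M h] [M' h']; exists (M + M') => j; rewrite mulrDl.
exact: le_trans (ler_normD _ _) (lerD (h j) (h' j)).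
Qed.

Lemma geoZ c a : geo a -> geo (fun j => c * a j).
Proof.
by move=> [M h]; exists (`|c| * M) => j; rewrite normrM -mulrA ler_wpM2l.
Qed.

Lemma cevD a b w : geo a -> geo b -> cmod w <= 1 ->
  cev (fun j => a j + b j) w = cev a w + cev b w.
Proof.
move=> ha hb w1; apply: cseries_eq.
apply: eq_csum_to (csum_toD (cev_sum ha w1) (cev_sum hb w1)) => j.
by rewrite rmorphD mulrDl.
Qed.

Lemma cevZ c a w : geo a -> cmod w <= 1 ->
  cev (fun j => c * a j) w = c%:C * cev a w.
Proof.
move=> ha w1; apply: cseries_eq.
apply: eq_csum_to (csum_toZ c%:C (cev_sum ha w1)) => j.
by rewrite rmorphM mulrA.
Qed.

(** Multiplication of the power series by w. *)
Definition shift a j := if j is j'.+1 then a j' else 0.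

Lemma gb_shift r M a : 0 < r -> gb r M a -> gb r (M / r) (shift a).
Proof.
move=> r0 h [|j] /=.
  by rewrite normr0 expr0 mulr1 divr_ge0 ?(gb_ge0 h) // ltW.
by apply: le_trans (h j) _; rewrite exprS mulrA divfK // gt_eqF.
Qed.

Lemma geo_shift a : geo a -> geo (shift a).
Proof. by move=> [M h]; exists (M / (1 / 2)); apply: gb_shift => //; lra. Qed.

Lemma cev_shift a w : geo a -> cmod w <= 1 -> cev (shift a) w = w * cev a w.
Proof.
move=> ha w1; apply: cseries_eq; rewrite -[w * _]add0r.
have -> : (0 : R[i]) = (shift a 0)%:C * w ^+ 0 by rewrite /= expr0 mulr1.
apply: csum_toS.
apply: eq_csum_to (csum_toZ w (cev_sum ha w1)) => j /=.
by rewrite exprS mulrCA.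
Qed.

Lemma cev0 a : cev a 0 = (a 0%N)%:C.
Proof.
apply: cseries_eq => e e0; exists 1%N => -[//|n] _.
rewrite big_ord_recl /= expr0 mulr1 big1 ?addr0 ?subrr ?cmod0 ?ltW // => i _.
by rewrite expr0n mulr0.
Qed.

Lemma cev_real a (x : R) : cev a x%:C = (complex.Re (cev a x%:C))%:C.
Proof.
have e : (fun j => (a j)%:C * x%:C ^+ j) = (fun j => (a j * x ^+ j)%:C).
  by apply/funext => j; rewrite rmorphM rmorphXn.
by rewrite /cev e; exact: cseries_real.
Qed.

Lemma cev_conj a w : geo a -> cmod w <= 1 -> cev a w^* = (cev a w)^*.
Proof.
move=> ha w1; apply: cseries_eq => e /(cev_sum ha w1) [N hN]; exists N => n /hN.
rewrite -(cmod_conj (_ - _)) rmorphB rmorph_sum /=.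
rewrite (eq_bigr (fun j : 'I_n => (a j)%:C * w^* ^+ j)) // => j _.
by rewrite rmorphM rmorphXn /= oppr0.
Qed.

Lemma exprB_le w z n : cmod w <= 1 -> cmod z <= 1 ->
  cmod (w ^+ n - z ^+ n) <= n%:R * cmod (w - z).
Proof.
move=> w1 z1; elim: n => [|n IH]; first by rewrite !expr0 subrr cmod0 mul0r.
have -> : w ^+ n.+1 - z ^+ n.+1 = w * (w ^+ n - z ^+ n) + (w - z) * z ^+ n.
  by rewrite !exprS; ring.
apply: le_trans (cmodD _ _) _; rewrite !cmodM -natr1 [X in _ <= X]mulrDl mul1r lerD //.
  by apply: le_trans IH; rewrite ler_piMl ?cmod_ge0.
by rewrite ler_piMr ?cmod_ge0 // cmodX exprn_ile1 ?cmod_ge0.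
Qed.

Lemma nat_le_exp2 n : (n%:R : R) <= 2 ^+ n.
Proof. by rewrite -natrX ler_nat; elim: n => // n IH; rewrite expnS; lia. Qed.

(** Termwise, w ^ j - z ^ j costs a factor j <= 2 ^ j, which turns the rate 1/4 into 1/2; the
    remaining geometric sum is at most 2. *)
Lemma cev_lipschitz M a w z : gb (1 / 4) M a -> cmod w <= 1 -> cmod z <= 1 ->
  cmod (cev a w - cev a z) <= 2 * M * cmod (w - z).
Proof.
move=> h w1 z1; have ha := gb_quarter_geo h; have M0 := gb_ge0 h.
have := csum_toD (cev_sum ha w1) (csum_toZ (-1) (cev_sum ha z1)).
rewrite mulN1r => /csum_to_bound; apply => n.
apply: le_trans (cmod_sum _ _ _) _.
have hk (j : nat) : cmod ((a j)%:C * w ^+ j + -1 * ((a j)%:C * z ^+ j)) <=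
   (1 / 2) ^+ j * (M * cmod (w - z)).
  rewrite mulN1r -mulrBr cmodM cmodR.
  apply: le_trans (ler_pM _ _ (h j) (exprB_le j w1 z1)) _; rewrite ?cmod_ge0 //.
  rewrite [X in _ <= X]mulrCA -mulrA ler_wpM2l // mulrA ler_wpM2r ?cmod_ge0 //.
  apply: le_trans (ler_wpM2l _ (nat_le_exp2 j)) _; first by rewrite exprn_ge0 //; lra.
  by rewrite -exprMn lerXn2r ?nnegrE //; lra.
apply: le_trans (ler_sum _ (fun (j : 'I_n) _ => hk j)) _; rewrite -mulr_suml.
rewrite -(big_mkord predT) -mulrA ler_wpM2r ?mulr_ge0 ?cmod_ge0 //.
apply: le_trans (geo_sum_le _ _ half01) _; rewrite expr0 ler_pdivrMr; lra.
Qed.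

(** Coefficients of the derivative in w. *)
Definition dsq a j := j.+1%:R * a j.+1.

Lemma gb_dsq M a : gb (1 / 4) M a -> gb (1 / 2) M (dsq a).
Proof.
move=> h j; rewrite /dsq normrM ger0_norm ?ler0n //.
apply: le_trans (ler_wpM2l _ (h j.+1)) _ => //; rewrite mulrCA ler_wpM2l ?(gb_ge0 h) //.
apply: le_trans (ler_wpM2r _ (nat_le_exp2 j.+1)) _; first by rewrite exprn_ge0 //; lra.
rewrite -exprMn (_ : 2 * (1 / 4) = 1 / 2); last by lra.
by rewrite exprS; have : 0 <= (1 / 2 : R) ^+ j; [rewrite exprn_ge0 //; lra|lra].
Qed.

(** The product rule (w f)' = f + w f', on coefficients. *)
Lemma dsq_shift a j : dsq (shift a) j = a j + shift (dsq a) j.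
Proof.
case: j => [|j]; rewrite /dsq /=; first by rewrite mul1r addr0.
by rewrite -[in LHS]natr1; ring.
Qed.

Lemma cev_dsq_shift M a w : gb (1 / 4) M a -> cmod w <= 1 ->
  cev (dsq (shift a)) w = cev a w + w * cev (dsq a) w.
Proof.
move=> h w1; rewrite (funext (dsq_shift a)).
have gd : geo (dsq a) by exists M; exact: gb_dsq.
by rewrite cevD ?cev_shift //; [exact: gb_quarter_geo h|exact: geo_shift].
Qed.

(* Coefficients of the quotient (f w - f x) / (w - x). *)
Definition defl (x : R) a j :=
  complex.Re (cseries (fun i => (a (j + i).+1 * x ^+ i)%:C)).

Lemma defl_terms M a (x : R) : gb (1 / 4) M a -> 0 <= x <= 1 -> forall j i : nat,
  cmod (a (j + i).+1 * x ^+ i)%:C <= M * (1 / 4) ^+ j.+1 * (1 / 4) ^+ i.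
Proof.
move=> h /andP[x0 x1] j i; rewrite cmodR normrM -mulrA -exprD addSn.
apply: le_trans (h _); rewrite ler_piMr // normrX exprn_ile1 //.
by rewrite ger0_norm.
Qed.

(** The constant is 2 * (1/4) / (1 - 1/4): the index shift gains 1/4, the geometric sum costs 4/3,
    and [cseries_tail] costs 2. It is less than 1, and the count of zeros in [zeros_bounded] rests
    on this. *)
Lemma gb_defl M a (x : R) : gb (1 / 4) M a -> 0 <= x <= 1 ->
  gb (1 / 4) (2 / 3 * M) (defl x a).
Proof.
move=> h x01 j.
have := cseries_tail quarter01 (defl_terms h x01 j) 0.
rewrite big_ord0 subr0 expr0 => hh; apply: le_trans (Re_le_cmod _) _.
apply: le_trans hh _; rewrite exprS.
by rewrite le_eqVlt; apply/orP; left; apply/eqP; field.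
Qed.

(** One step of synthetic division; [defl0] is the last step, whose remainder is the value at x. *)
Lemma deflS M a (x : R) : gb (1 / 4) M a -> 0 <= x <= 1 -> forall j,
  defl x a j = a j.+1 + x * defl x a j.+1.
Proof.
move=> h x01 j; apply: complexI; rewrite rmorphD rmorphM /= /defl -!cseries_real.
apply: cseries_eq.
have hs (l : nat) : csum_to (fun i => (a (l + i).+1 * x ^+ i)%:C)
    (cseries (fun i => (a (l + i).+1 * x ^+ i)%:C)).
  apply: geo_csum_to; eexists; exists (1 / 4).
  by split; [exact: quarter01|exact: defl_terms].
have -> : (a j.+1)%:C = (a (j + 0).+1 * x ^+ 0)%:C by rewrite addn0 expr0 mulr1.
apply: (@csum_toS _ (fun i => (a (j + i).+1 * x ^+ i)%:C)).
apply: eq_csum_to (csum_toZ x%:C (hs j.+1)) => i /=.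
by rewrite -rmorphM /= addSnnS exprS mulrCA.
Qed.

Lemma defl0 M a (x : R) : gb (1 / 4) M a -> 0 <= x <= 1 ->
  cev a x%:C = (a 0%N + x * defl x a 0)%:C.
Proof.
move=> h /andP[x0 x1]; have x1' : cmod x%:C <= 1 by rewrite cmodR ger0_norm.
apply: cseries_eq; rewrite rmorphD rmorphM /= /defl -!cseries_real.
have -> : (a 0%N)%:C = (a 0%N)%:C * x%:C ^+ 0 by rewrite expr0 mulr1.
apply: csum_toS; apply: eq_csum_to (csum_toZ x%:C (geo_csum_to _)).
  by move=> i /=; rewrite -!rmorphXn -!rmorphM /= add0n exprS mulrCA.
eexists; exists (1 / 4); split; first exact: quarter01.
by apply: (defl_terms h); rewrite x0.
Qed.

Lemma defl_root M a (x : R) : gb (1 / 4) M a -> 0 <= x <= 1 -> cev a x%:C = 0 ->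
  a = (fun j => shift (defl x a) j + - x * defl x a j).
Proof.
move=> h x01; rewrite (defl0 h x01) => -[e]; apply/funext => -[|j] /=.
  by apply/eqP; rewrite add0r mulNr -subr_eq0 opprK e.
by rewrite (deflS h x01 j) mulNr addrK.
Qed.

Lemma cev_defl_root M a (x : R) w : gb (1 / 4) M a -> 0 <= x <= 1 ->
  cev a x%:C = 0 -> cmod w <= 1 -> cev a w = (w - x%:C) * cev (defl x a) w.
Proof.
move=> h x01 e w1; rewrite {1}(defl_root h x01 e).
have g := gb_quarter_geo (gb_defl h x01).
by rewrite cevD ?cevZ ?cev_shift // ?rmorphN /= ?mulrBl ?mulNr //;
  [exact: geo_shift|exact: geoZ].
Qed.

(** Product rule for (w - x) times the quotient; at w = x it says that the quotient takes the value
    f'(x). *)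
Lemma cev_dsq_defl_root M a (x : R) w : gb (1 / 4) M a -> 0 <= x <= 1 ->
  cev a x%:C = 0 -> cmod w <= 1 ->
  cev (dsq a) w = cev (defl x a) w + (w - x%:C) * cev (dsq (defl x a)) w.
Proof.
move=> h x01 e w1; rewrite {1}(defl_root h x01 e).
have g := gb_defl h x01; have gg := gb_quarter_geo g.
have -> : dsq (fun j => shift (defl x a) j + - x * defl x a j) =
   (fun j => dsq (shift (defl x a)) j + - x * dsq (defl x a) j).
  by apply/funext => j; rewrite /dsq mulrDr mulrCA.
have gd : geo (dsq (defl x a)) by eexists; exact: gb_dsq g.
have gds : geo (dsq (shift (defl x a))).
  rewrite (funext (dsq_shift _)); apply: geoD => //; exact: geo_shift.
rewrite cevD ?cevZ ?(cev_dsq_shift g) //; last exact: geoZ.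
by rewrite rmorphN /=; ring.
Qed.

End PowerSeries.

(** * The q-series coefficients *)

Section LinearFactors.
Variable R : realType.
Implicit Types (a : nat -> R) (A B M : R).

(** Only the factors from index I on are small; the induction on I peels off the others one at a
    time and absorbs them into M. *)
Lemma prod_geo (F : nat -> R) (s : R) (I : nat) : 0 < s -> (forall i, 0 <= F i) ->
  (forall i, (I <= i)%N -> F i <= s) -> exists M, forall n, \prod_(i < n) F i <= M * s ^+ n.
Proof.
move=> s0; elim: I F => [|I IH] F F0 hF.
  exists 1 => n; rewrite mul1r -[n in s ^+ n]card_ord -prodr_const.
  by apply: ler_prod => i _; rewrite F0 hF.
have [M hM] := IH (fun i => F i.+1) (fun i => F0 i.+1) (fun i Ii => hF i.+1 Ii).
exists (1 + F 0%N * M / s) => -[|n].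
  rewrite big_ord0 expr0 mulr1 lerDl divr_ge0 ?(ltW s0) // mulr_ge0 //.
  by have := hM 0%N; rewrite big_ord0 expr0 mulr1; apply: le_trans.
rewrite big_ord_recl mulrDl mul1r.
apply: le_trans (ler_wpM2l (F0 0%N) (hM n)) _; rewrite exprS.
have -> : F 0%N * M / s * (s * s ^+ n) = F 0%N * (M * s ^+ n).
  by field; rewrite gt_eqF.
by rewrite lerDr mulr_ge0 ?exprn_ge0 // ltW.
Qed.

(** Multiplication of the power series by A + B w. In [gb_mul_lin] the 4 is the price 1 / (1/4) of a
    shift. *)
Definition mul_lin A B a j := A * a j + B * shift a j.

Lemma gb_mul_lin A B M a : gb (1 / 4) M a ->
  gb (1 / 4) ((`|A| + 4 * `|B|) * M) (mul_lin A B a).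
Proof.
move=> h j; have h4 : 0 < (1 / 4 : R) by lra.
have := gb_shift h4 h j; rewrite div1r invrK => hs.
apply: le_trans (ler_normD _ _) _; rewrite !normrM.
have := ler_wpM2l (normr_ge0 A) (h j); have := ler_wpM2l (normr_ge0 B) hs.
by rewrite div1r; lra.
Qed.

Lemma geo_mul_lin A B a : geo a -> geo (mul_lin A B a).
Proof. by move=> h; apply: geoD; apply: geoZ => //; exact: geo_shift. Qed.

Lemma cev_mul_lin A B a w : geo a -> cmod w <= 1 ->
  cev (mul_lin A B a) w = (A%:C + B%:C * w) * cev a w.
Proof.
move=> h w1; have hs := geo_shift h.
rewrite cevD ?cevZ ?cev_shift //; [by ring|exact: geoZ|exact: geoZ].
Qed.

Lemma mul_linC A B A' B' a :
  mul_lin A B (mul_lin A' B' a) = mul_lin A' B' (mul_lin A B a).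
Proof. by apply/funext => -[|j]; rewrite /mul_lin /=; ring. Qed.

End LinearFactors.

Section QSeries.
Variables (R : realType) (q : R).
Hypothesis q01 : 0 < q < 1.

Let q0 : 0 < q. Proof. by case/andP: q01. Qed.
Let q0' : 0 <= q. Proof. exact: ltW. Qed.
Let q1 : q < 1. Proof. by case/andP: q01. Qed.
Let q01' : 0 <= q < 1. Proof. by rewrite q0'. Qed.

Lemma qX_le1 n : q ^+ n <= 1.
Proof. by rewrite exprn_ile1 // ltW. Qed.

Lemma qX_gt0 n : 0 < q ^+ n.
Proof. exact: exprn_gt0. Qed.

Lemma one_sub_qX n : 0 < 1 - q ^+ n.+1.
Proof. by rewrite subr_gt0 exprn_ilt1. Qed.

(* Euler: (a; q)_oo = sum_j ecoef j * a ^ j, an entire function of a. *)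
Definition ecoef j : R := \prod_(i < j) (- q ^+ i / (1 - q ^+ i.+1)).

(** The ratio of consecutive coefficients tends to 0, hence is eventually below 1/4. *)
Lemma ecoef_bound : exists M, gb (1 / 4) M ecoef.
Proof.
have h4 : 0 < (1 / 4 : R) by lra.
have d0 : 0 < 1 - q by rewrite subr_gt0.
have [I hI] := small_geo (1 - q)^-1 q01' h4.
pose F i := q ^+ i / (1 - q ^+ i.+1).
have F0 i : 0 <= F i by rewrite divr_ge0 ?exprn_ge0 // ltW // one_sub_qX.
have hF i : (I <= i)%N -> F i <= 1 / 4.
  move=> /hI; apply: le_trans; rewrite /F mulrC ler_wpM2r ?exprn_ge0 //.
  by rewrite lef_pV2 ?posrE ?one_sub_qX // lerB // exprS ler_piMr // qX_le1.
have [M hM] := prod_geo h4 F0 hF.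
exists M => j; rewrite normr_prod; apply: le_trans (hM j).
rewrite le_eqVlt; apply/orP; left; apply/eqP; apply: eq_bigr => i _.
rewrite normrM normrN normfV !ger0_norm // ?exprn_ge0 // ltW // one_sub_qX //.
Qed.

(* Coefficients in w of (q^(k+1) w; q)_oo. *)
Definition xk k j := ecoef j * q ^+ (k.+1 * j).

(** This functional equation, together with the limit 1 of [xk_to1], is what identifies [xk] with
    the infinite product. *)
Lemma xk_rec k : xk k = mul_lin 1 (- q ^+ k.+1) (xk k.+1).
Proof.
apply/funext => -[|j]; rewrite /xk /mul_lin /=.
  by rewrite !muln0 mul1r mulr0 addr0.
rewrite /ecoef big_ord_recr /= mul1r.
have e1 : (k.+1 * j.+1 = k.+1 * j + k.+1)%N by lia.
have e2 : (k.+2 * j.+1 = k.+1 * j + j.+1 + k.+1)%N by lia.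
have e3 : (k.+2 * j = k.+1 * j + j)%N by lia.
rewrite e1 e2 e3 !exprD; have := one_sub_qX j; rewrite exprS => hj.
by field; rewrite gt_eqF.
Qed.

Lemma gb_xk M k : gb (1 / 4) M ecoef -> gb (1 / 4) M (xk k).
Proof.
move=> h j; rewrite /xk normrM; apply: le_trans (h j); rewrite ler_piMr //.
by rewrite ger0_norm ?exprn_ge0 // qX_le1.
Qed.

Lemma geo_xk k : geo (xk k).
Proof. by have [M h] := ecoef_bound; exact: gb_quarter_geo (gb_xk k h). Qed.

(** The constant coefficient is exactly 1, and every other one carries a power of q of exponent at
    least k. *)
Lemma xk_to1 : exists M, forall k w, cmod w <= 1 -> cmod (cev (xk k) w - 1) <= M * q ^+ k.
Proof.
have [M h] := ecoef_bound; exists (2 * (M / (1 - 1 / 4))) => k w w1.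
have g : gb (1 / 4) (M * q ^+ k) (fun j => xk k j + - 1 * (j == 0)%:R).
  move=> [|j]; rewrite /xk.
    rewrite muln0 /ecoef big_ord0 !mulr1 subrr normr0 mulr_ge0 ?exprn_ge0 //.
    exact: gb_ge0 h.
  rewrite mulr0 addr0 normrM; have := h j.+1 => hj.
  rewrite mulrAC; apply: ler_pM; rewrite ?normr_ge0 ?hj //.
  rewrite ger0_norm ?exprn_ge0 // mulnS exprD -[X in _ <= X]mulr1 ler_pM ?exprn_ge0 ?qX_le1 //.
  by rewrite exprS ler_piMl ?exprn_ge0 // ltW.
have := cev_bound (quarter01 R) g w1.
have g1 : geo (fun j => (j == 0%N)%:R : R).
  exists 1 => -[|j]; rewrite ?normr1 ?normr0 mul1r ?expr0 // exprn_ge0 //.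
rewrite cevD ?cevZ //; [|exact: geo_xk|exact: geoZ].
have -> : cev (fun j => (j == 0%N)%:R : R) w = 1.
  apply: cseries_eq => e e0; exists 1%N => -[//|n] _.
  rewrite big_ord_recl /= expr0 !mulr1 big1 ?addr0 ?subrr ?cmod0 ?ltW // => i _.
  by rewrite mul0r.
rewrite rmorphN mulr1 => hh; apply: le_trans hh _.
by rewrite le_eqVlt; apply/orP; left; apply/eqP; ring.
Qed.

Lemma cev_xk_rec k w : cmod w <= 1 ->
  cev (xk k) w = (1 - (q ^+ k.+1)%:C * w) * cev (xk k.+1) w.
Proof.
move=> w1; rewrite {1}xk_rec cev_mul_lin //; last exact: geo_xk.
by rewrite rmorphN mulNr.
Qed.

Lemma cev_xk_prod k n w : cmod w <= 1 ->
  cev (xk k) w = qpoch ((q ^+ k.+1)%:C * w) q%:C n * cev (xk (k + n)) w.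
Proof.
move=> w1; elim: n => [|n IH]; first by rewrite /qpoch big_ord0 mul1r addn0.
rewrite IH cev_xk_rec // addnS mulrA /qpoch big_ord_recr /=; congr (_ * _ * _).
by rewrite -addSn exprD rmorphM /= [(q ^+ n)%:C]rmorphXn /= mulrAC.
Qed.

Lemma one_sub_qXw k w : cmod w <= 1 -> 1 - (q ^+ k.+1)%:C * w != 0.
Proof.
move=> w1; rewrite subr_eq0 eq_sym; apply/eqP => /(congr1 (@cmod R)).
rewrite cmodM cmodR cmod1 ger0_norm ?exprn_ge0 // => h.
have : q ^+ k.+1 * cmod w < 1.
  by apply: le_lt_trans (_ : q ^+ k.+1 < 1); rewrite ?ler_piMr ?exprn_ge0 ?exprn_ilt1.
by rewrite h ltxx.
Qed.

(** For a large index the value lies within 1/2 of 1; the finitely many factors 1 - q ^ i w in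
    between do not vanish on the disc. *)
Lemma cev_xk_neq0 k w : cmod w <= 1 -> cev (xk k) w != 0.
Proof.
move=> w1; have [M hM] := xk_to1.
have h2 : 0 < (1 / 2 : R) by lra.
have [N hN] := small_geo M q01' h2.
rewrite (cev_xk_prod k N w1) mulf_neq0 //.
  apply/prodf_neq0 => i _; rewrite -rmorphXn mulrAC -rmorphM -exprD addSn.
  exact: one_sub_qXw.
apply/eqP => e; have := hM (k + N)%N w w1; rewrite e sub0r cmodN cmod1.
by have := hN (k + N)%N (leq_addl _ _); lra.
Qed.

Variables alpha beta : R.

(* Writing w = z ^ 2, the factors of c_k(z) are Afac j + Bfac j * w. *)
Definition Afac k : R := alpha - beta * q ^+ k.
Definition Bfac k : R := alpha * q ^+ (2 * k) - beta * q ^+ k.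

Fixpoint cmul k (a : nat -> R) : nat -> R :=
  if k is k'.+1 then mul_lin (Afac k') (Bfac k') (cmul k' a) else a.

(* Coefficients in w = z ^ 2 of t_k = (q^(k+1) w; q)_oo c_k(z) / (q; q)_k. *)
Definition tau k j := (qpoch q q k)^-1 * cmul k (xk k) j.

Lemma tauE k : tau k = fun j => (qpoch q q k)^-1 * cmul k (xk k) j.
Proof. by []. Qed.

Lemma cmul_mul_lin k A B a : cmul k (mul_lin A B a) = mul_lin A B (cmul k a).
Proof. by elim: k => //= k ->; rewrite mul_linC. Qed.

Lemma qpoch_gt0 k : 0 < qpoch q q k.
Proof. by apply: prodr_gt0 => i _; rewrite -exprS one_sub_qX. Qed.

(** In terms of functions: (1 - q^(k+1)) (1 - q^(k+1) w) t_(k+1) = (A_k + B_k w) t_k, because the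
    infinite product loses the factor 1 - q^(k+1) w when k increases. *)
Lemma tau_rec k j : (1 - q ^+ k.+1) * (tau k.+1 j - q ^+ k.+1 * shift (tau k.+1) j)
  = Afac k * tau k j + Bfac k * shift (tau k) j.
Proof.
have hs l : shift (tau l) j = (qpoch q q l)^-1 * shift (cmul l (xk l)) j.
  by case: j => //=; rewrite mulr0.
have h : mul_lin 1 (- q ^+ k.+1) (cmul k.+1 (xk k.+1)) j =
    mul_lin (Afac k) (Bfac k) (cmul k (xk k)) j.
  by rewrite -cmul_mul_lin -xk_rec.
move: h; rewrite {1 2}/mul_lin mul1r mulNr !hs /tau => h.
have -> : qpoch q q k.+1 = qpoch q q k * (1 - q ^+ k.+1).
  by rewrite /qpoch big_ord_recr /= exprS.
transitivity ((qpoch q q k)^-1 *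
  (cmul k.+1 (xk k.+1) j - q ^+ k.+1 * shift (cmul k.+1 (xk k.+1)) j)).
  move: (qpoch_gt0 k) (one_sub_qX k); set Q := qpoch q q k; set d := 1 - _ => Q0 d0.
  by field; rewrite !gt_eqF.
by rewrite h; ring.
Qed.

Hypothesis al1 : -1 < alpha < 1.

(** Passing from t_k to t_(k+1) multiplies the coefficient bound by [F k], which tends to |alpha|; s
    is chosen halfway between |alpha| and 1. This is where |alpha| < 1 gives convergence of the
    series in k, even for N = 0. *)
Lemma tau_bound : exists M s : R, [/\ 0 <= s < 1, 0 <= M & forall k, gb (1 / 4) (M * s ^+ k) (tau k)].
Proof.
have [M0 h0] := ecoef_bound.
have a1 : `|alpha| < 1 by rewrite ltr_norml.
set s := (1 + `|alpha|) / 2; have s0 : 0 < s by rewrite /s; have := normr_ge0 alpha; lra.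
set F := fun i => (`|Afac i| + 4 * `|Bfac i|) / (1 - q ^+ i.+1).
have F0 i : 0 <= F i.
  rewrite /F divr_ge0 //; last exact: ltW (one_sub_qX i).
(* The numerator of [F i] is at most |alpha| + K q^i; the further s q^i in the choice of I pays for
   the denominator 1 - q^(i+1). *)
set K := 4 * `|alpha| + 5 * `|beta|.
have e0 : 0 < (1 - `|alpha|) / 2 by lra.
have [I hI] := small_geo (K + s) q01' e0.
have hF i : (I <= i)%N -> F i <= s.
  move=> Ii; rewrite ler_pdivrMr ?one_sub_qX //; have := hI i Ii.
  have p0 : 0 <= q ^+ i by rewrite exprn_ge0.
  have p1 : q ^+ (2 * i) <= q ^+ i.
    by rewrite mul2n -addnn exprD ler_piMl // qX_le1.
  have p2 : 0 <= q ^+ (2 * i) by rewrite exprn_ge0.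
  have hA : `|Afac i| <= `|alpha| + `|beta| * q ^+ i.
    by apply: le_trans (ler_normB _ _) _; rewrite normrM (ger0_norm p0).
  have hB : `|Bfac i| <= (`|alpha| + `|beta|) * q ^+ i.
    apply: le_trans (ler_normB _ _) _; rewrite !normrM (ger0_norm p0) (ger0_norm p2).
    by rewrite mulrDl lerD // ler_wpM2l.
  have p3 : q ^+ i.+1 <= q ^+ i by rewrite exprS ler_piMl // ltW.
  have p4 : s * q ^+ i.+1 <= s * q ^+ i by rewrite ler_wpM2l // ltW.
  rewrite /K => h.
  have -> : s * (1 - q ^+ i.+1) = s - s * q ^+ i.+1 by ring.
  have hs : s - `|alpha| = (1 - `|alpha|) / 2 by rewrite /s; field.
  lra.
have [M hM] := prod_geo s0 F0 hF.
have M00 := gb_ge0 h0.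
have Mp : 0 <= M by have := hM 0%N; rewrite big_ord0 expr0 mulr1; apply: le_trans.
exists (M * M0), s; split; [|by rewrite mulr_ge0|move=> k].
  by apply/andP; split; [exact: ltW|rewrite /s; lra].
have hc l b : gb (1 / 4) M0 b -> gb (1 / 4) ((\prod_(i < l) (`|Afac i| + 4 * `|Bfac i|)) * M0)
    (cmul l b).
  move=> hb; elim: l => [|l IH] /=; first by rewrite big_ord0 [1 * M0]mul1r.
  by rewrite big_ord_recr /= [X in gb _ (X * _)]mulrC -mulrA; apply: gb_mul_lin.
move=> j; rewrite /tau normrM.
apply: le_trans (ler_wpM2l _ (hc k _ (gb_xk k h0) j)) _ => //.
rewrite mulrA ler_wpM2r ?exprn_ge0 //.
rewrite mulrA [X in _ <= X]mulrAC ler_wpM2r //.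
apply: le_trans (hM k); rewrite ger0_norm ?invr_ge0 ?(ltW (qpoch_gt0 _)) //.
rewrite mulrC /F big_split /= prodfV (_ : qpoch q q k = \prod_(i < k) (1 - q ^+ i.+1)) //.
by apply: eq_bigr => i _; rewrite exprS.
Qed.

(* Coefficients in w of T_N = sum_k t_k q^(N k), so that psi_n(z) = z^n T_(n+1)(z^2). *)
Definition tc N j := complex.Re (cseries (fun k => (tau k j * q ^+ (N * k))%:C)).

(** U and V stand for one coefficient of t_k and of w t_k. Stating the summation abstractly lets the
    coefficient of index 0, where the shifted sequence is 0, be treated like the others. *)
Lemma tc_rec_abs (U V : nat -> R) (SU SV : nat -> R) :
  (forall N, csum_to (fun k => (U k * q ^+ (N * k))%:C) (SU N)%:C) ->
  (forall N, csum_to (fun k => (V k * q ^+ (N * k))%:C) (SV N)%:C) ->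
  (forall k, (1 - q ^+ k.+1) * (U k.+1 - q ^+ k.+1 * V k.+1) = Afac k * U k + Bfac k * V k) ->
  forall N, (1 - alpha * q ^+ N) * (SU N + SV N.+2) = (1 - beta * q ^+ N) * (SU N.+1 + SV N.+1).
Proof.
move=> hU hV hr N.
(* The same series is summed twice: expanding the product gives [h1], while the recurrence, used
   after dropping the vanishing term k = 0, gives [h2]. *)
set D := fun k => ((1 - q ^+ k) * (U k - q ^+ k * V k) * q ^+ (N * k))%:C.
have h1 : csum_to D (SU N - SU N.+1 - SV N.+1 + SV N.+2)%:C.
  have := csum_toD (csum_toD (csum_toD (hU N) (csum_toZ (-1) (hU N.+1)))
     (csum_toZ (-1) (hV N.+1))) (hV N.+2).
  rewrite !mulN1r -!rmorphN -!rmorphD /=; apply: eq_csum_to => k; rewrite /D; cbv beta.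
  by rewrite -!rmorphM -!rmorphD /= !mulSn !exprD; congr (_%:C); ring.
have h2 : csum_to D (q ^+ N * (alpha * SU N - beta * SU N.+1
    + alpha * SV N.+2 - beta * SV N.+1))%:C.
  rewrite -[X in csum_to _ X]add0r (_ : 0 = D 0%N); last first.
    by rewrite /D expr0 subrr !mul0r.
  apply: csum_toS.
  have := csum_toZ (q ^+ N)%:C (csum_toD (csum_toD (csum_toD (csum_toZ alpha%:C (hU N))
     (csum_toZ (- beta)%:C (hU N.+1))) (csum_toZ alpha%:C (hV N.+2)))
     (csum_toZ (- beta)%:C (hV N.+1))).
  rewrite -!rmorphM -!rmorphD /= -!rmorphM /= -!mulNr; apply: eq_csum_to => k; cbv beta.
  rewrite -!rmorphM -!rmorphD /= -!rmorphM /= /D hr /Afac /Bfac mulnS !mulSn !exprD.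
  by congr (_%:C); ring.
have [e] := csum_to_unique h1 h2.
by apply/eqP; rewrite -subr_eq0; apply/eqP; lra.
Qed.

Lemma tau_qX_bound : exists M s : R, [/\ 0 <= s < 1, 0 <= M & forall N k j,
  cmod (tau k j * q ^+ (N * k))%:C <= M * (1 / 4) ^+ j * s ^+ k].
Proof.
have [M [s [s01 M0 h]]] := tau_bound; exists M, s; split => // N k j.
rewrite cmodR normrM mulrAC; apply: le_trans (h k j).
by rewrite ler_piMr // ger0_norm ?exprn_ge0 // qX_le1.
Qed.

Lemma tc_sum N j : csum_to (fun k => (tau k j * q ^+ (N * k))%:C) (tc N j)%:C.
Proof.
rewrite /tc -cseries_real; apply: geo_csum_to.
have [M [s [s01 M0 h]]] := tau_qX_bound.
by exists (M * (1 / 4) ^+ j), s; split.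
Qed.

Lemma tc_rec N j : (1 - alpha * q ^+ N) * (tc N j + shift (tc N.+2) j)
   = (1 - beta * q ^+ N) * (tc N.+1 j + shift (tc N.+1) j).
Proof.
apply: (@tc_rec_abs (fun k => tau k j) (fun k => shift (tau k) j)
   (fun N => tc N j) (fun N => shift (tc N) j)).
- by move=> K; exact: tc_sum.
- move=> K; case: j => [|j] /=; last exact: tc_sum.
  by move=> e e0; exists 0%N => n _; rewrite big1 ?subrr ?cmod0 ?ltW // => i _; rewrite mul0r.
- by move=> k; exact: tau_rec.
Qed.

(** Geometric decay in j and K at once, uniformly in N: this permits the exchange of the sum over k
    with evaluation in w in [jost_sum]. *)
Lemma tc_tail : exists M s : R, [/\ 0 <= s < 1, 0 <= M & forall N K,
  gb (1 / 4) (M * s ^+ K) (fun j => tc N j - \sum_(k < K) tau k j * q ^+ (N * k))].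
Proof.
have [M [s [s01 M0 h]]] := tau_qX_bound.
have s1 : 0 < 1 - s by rewrite subr_gt0; case/andP: s01.
exists (2 * (M / (1 - s))), s; split => [//||N K j].
  by rewrite mulr_ge0 // divr_ge0 // ltW.
have := cseries_tail s01 (fun k => h N k j) K.
rewrite cseries_real -/(tc N j) -rmorph_sum -rmorphB /= cmodR => hh.
apply: le_trans hh _; rewrite le_eqVlt; apply/orP; left; apply/eqP.
by field; rewrite gt_eqF.
Qed.

Lemma tc_bound : exists M, forall N, gb (1 / 4) M (tc N).
Proof.
have [M [s [s01 M0 h]]] := tc_tail; exists M => N j.
by have := h N 0%N j; rewrite expr0 mulr1 big_ord0 subr0.
Qed.

Lemma geo_tc N : geo (tc N).
Proof. by have [M h] := tc_bound; exact: gb_quarter_geo (h N). Qed.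

Lemma tau0 : tau 0 = xk 0.
Proof. by apply/funext => j; rewrite /tau /= /qpoch big_ord0 invr1 mul1r. Qed.

(** The term k = 0 does not depend on N and equals (q w; q)_oo; all later terms carry a factor q ^
    N. *)
Lemma tc_lim : exists M, forall N, gb (1 / 4) (M * q ^+ N) (fun j => tc N j + - 1 * xk 0 j).
Proof.
have [M [s [s01 M0 h]]] := tau_bound.
have s1 : 0 < 1 - s by rewrite subr_gt0; case/andP: s01.
exists (2 * (M / (1 - s))) => N j.
have hk k : cmod (tau k.+1 j * q ^+ (N * k.+1))%:C <= M * q ^+ N * (1 / 4) ^+ j * s ^+ k.
  rewrite cmodR normrM.
  have -> : M * q ^+ N * (1 / 4) ^+ j * s ^+ k = (M * s ^+ k * (1 / 4) ^+ j) * q ^+ N by ring.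
  apply: ler_pM => //.
    apply: le_trans (h _ _) _; rewrite ler_wpM2r ?exprn_ge0 //.
    rewrite ler_wpM2l // exprS ler_piMl ?exprn_ge0 //; case/andP: s01 => // *; exact: ltW.
  by rewrite ger0_norm ?exprn_ge0 // mulnS exprD ler_piMr ?exprn_ge0 // qX_le1.
have hs : csum_to (fun k => (tau k.+1 j * q ^+ (N * k.+1))%:C)
    (cseries (fun k => (tau k.+1 j * q ^+ (N * k.+1))%:C)).
  by apply: geo_csum_to; exists (M * q ^+ N * (1 / 4) ^+ j), s.
have := csum_to_unique (tc_sum N j) (csum_toS (u := fun k => (tau k j * q ^+ (N * k))%:C) hs).
rewrite muln0 expr0 mulr1 tau0 cseries_real -rmorphD => /complexI ->.
rewrite mulN1r addrAC subrr add0r; apply: le_trans (Re_le_cmod _) _.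
have := cseries_tail s01 hk 0; rewrite big_ord0 subr0 => hh; apply: le_trans hh _.
rewrite expr0 le_eqVlt; apply/orP; left; apply/eqP.
by field; rewrite gt_eqF.
Qed.

End QSeries.

(** * Jost solutions *)

Section Wronskian.
Variable R : realType.

(** Multiply the recurrence by the conjugate of z T1 and take imaginary parts: conj z (1 + z^2) has
    imaginary part Im z (|z|^2 - 1). *)
Lemma wronskian_step (z T0 T1 T2 : R[i]) (d : R) :
  T0 + z ^+ 2 * T2 = d%:C * ((1 + z ^+ 2) * T1) ->
  csqabs z * complex.Im (z * T2 * T1^*) =
  d * csqabs T1 * (complex.Im z * (csqabs z - 1)) + complex.Im (z * T1 * T0^*).
Proof.
move=> /(congr1 (fun u => complex.Im (z^* * T1^* * u))).
rewrite expr2 /csqabs; case: z => x y; case: T0 => a b; case: T1 => c e; case: T2 => g h /=.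
lra.
Qed.

(** The t's are values and the s's derivatives at w = a; the hypotheses are the recurrence and its
    derivative. With a = z^2, the bracket in t1, t2 is, up to a power of z, the Wronskian of z^n
    T_(n+1)(z^2) and its derivative in z. *)
Lemma derivative_wronskian_step (a d t0 t1 t2 s0 s1 s2 : R) :
  t0 + a * t2 = d * ((1 + a) * t1) ->
  s0 + (t2 + a * s2) = d * (s1 + (t1 + a * s1)) ->
  a * (- (t1 * t2) + 2 * a * (t2 * s1 - t1 * s2))
  = (1 - a) * d * t1 ^+ 2 + (- (t0 * t1) + 2 * a * (t1 * s0 - t0 * s1)).
Proof.
move=> e1 e2.
have h1 : a * t2 = d * ((1 + a) * t1) - t0 by rewrite -e1; ring.
have h2 : a * s2 = d * (s1 + (t1 + a * s1)) - s0 - t2 by rewrite -e2; ring.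
have -> : a * (- (t1 * t2) + 2 * a * (t2 * s1 - t1 * s2)) =
  - t1 * (a * t2) + 2 * a * (s1 * (a * t2) - t1 * (a * s2)) by ring.
rewrite h2 h1.
have -> : - t1 * (d * ((1 + a) * t1) - t0) + 2 * a * (s1 * (d * ((1 + a) * t1) - t0)
  - t1 * (d * (s1 + (t1 + a * s1)) - s0 - t2)) =
  - t1 * (d * ((1 + a) * t1) - t0) + 2 * a * (s1 * (d * ((1 + a) * t1) - t0)
  - t1 * (d * (s1 + (t1 + a * s1)) - s0)) + 2 * t1 * (a * t2) by ring.
by rewrite h1; ring.
Qed.

Lemma cmod_mul_close (x y x' y' : R[i]) (B e : R) :
  cmod x <= B -> cmod y' <= B -> cmod (x - x') <= e -> cmod (y - y') <= e ->
  cmod (x * y - x' * y') <= 2 * B * e.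
Proof.
move=> hx hy h1 h2.
have -> : x * y - x' * y' = x * (y - y') + (x - x') * y' by ring.
apply: le_trans (cmodD _ _) _; rewrite !cmodM.
have B0 : 0 <= B := le_trans (cmod_ge0 _) hx.
have h3 := ler_pM (cmod_ge0 _) (cmod_ge0 _) hx h2.
have h4 := ler_pM (cmod_ge0 _) (cmod_ge0 _) h1 hy.
by rewrite (_ : 2 * B * e = B * e + e * B); [exact: lerD|ring].
Qed.

End Wronskian.

Section QValues.
Variables (R : realType) (q alpha beta : R).
Hypothesis q01 : 0 < q < 1.
Hypothesis al1 : -1 < alpha < 1.
Hypothesis be1 : beta < 1.

Let q0 : 0 < q. Proof. by case/andP: q01. Qed.
Let q0' : 0 <= q. Proof. exact: ltW. Qed.
Let q1 : q < 1. Proof. by case/andP: q01. Qed.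
Let q01' : 0 <= q < 1. Proof. by rewrite q0'. Qed.

Local Notation tc := (tc q alpha beta).
Local Notation tau := (tau q alpha beta).
Local Notation xk := (xk q).

(** [jost], [djost] and [xinf] are T_N, its derivative in w, and (q w; q)_oo. *)
Definition jost N w := cev (tc N) w.
Definition djost N w := cev (dsq (tc N)) w.
Definition xinf w := cev (xk 0) w.

Lemma one_sub_alpha N : 0 < 1 - alpha * q ^+ N.
Proof.
rewrite subr_gt0; have := qX_le1 q01 N; have := qX_gt0 q01 N.
by case/andP: al1 => a1 a2; nra.
Qed.

Lemma one_sub_beta N : 0 < 1 - beta * q ^+ N.
Proof.
rewrite subr_gt0; have := qX_le1 q01 N; have := qX_gt0 q01 N.
by move: be1; case: (lerP beta 0) => b0 b1 p0 p1; nra.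
Qed.

Lemma gtil_gt0 N : 0 < gtil alpha beta q N.
Proof. by rewrite divr_gt0 ?one_sub_alpha ?one_sub_beta. Qed.

Let tcg := geo_tc q01 beta al1.

Lemma jost_rec N w : cmod w <= 1 ->
  jost N w + w * jost N.+2 w = ((gtil alpha beta q N)^-1)%:C * ((1 + w) * jost N.+1 w).
Proof.
move=> w1; rewrite /jost -!cev_shift // mulrDl mul1r -cev_shift //.
have gs := fun N => geo_shift (tcg N).
rewrite -!cevD // -cevZ //; last exact: geoD.
congr cev; apply/funext => j; rewrite /gtil invf_div.
apply: (mulfI (lt0r_neq0 (one_sub_alpha N))); rewrite (tc_rec q01 beta al1) mulrA.
by rewrite mulrCA divff ?mulr1 // gt_eqF // one_sub_alpha.
Qed.

Lemma djost_rec N w : cmod w <= 1 ->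
  djost N w + (jost N.+2 w + w * djost N.+2 w) =
  ((gtil alpha beta q N)^-1)%:C * (djost N.+1 w + (jost N.+1 w + w * djost N.+1 w)).
Proof.
move=> w1; have [M hM] := tc_bound q01 beta al1.
rewrite /jost /djost -(cev_dsq_shift (hM N.+2)) // -(cev_dsq_shift (hM N.+1)) //.
have gd K : geo (dsq (tc K)) by eexists; exact: gb_dsq (hM K).
have gs K : geo (dsq (shift (tc K))).
  by rewrite (funext (dsq_shift _)); apply: geoD => //; exact: geo_shift.
rewrite -!cevD // -cevZ //; last exact: geoD.
congr cev; apply/funext => j; rewrite /gtil invf_div /dsq -!mulrDr.
have := tc_rec q01 beta al1 N j.+1.
have h := lt0r_neq0 (one_sub_alpha N).
move=> e; rewrite mulrCA; congr (_ * _).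
by apply: (mulfI h); rewrite e mulrA mulrCA divff ?mulr1.
Qed.

Lemma jost_lim : exists M, forall N w, cmod w <= 1 -> cmod (jost N w - xinf w) <= M * q ^+ N.
Proof.
have [M hM] := tc_lim q01 beta al1; exists (2 * (M / (1 - 1 / 4))) => N w w1.
have := cev_bound (quarter01 R) (hM N) w1.
rewrite cevD ?cevZ //; [|exact: geo_xk|exact: geoZ (geo_xk q01 0)].
rewrite rmorphN mulN1r => h; apply: le_trans h _.
by rewrite le_eqVlt; apply/orP; left; apply/eqP; ring.
Qed.

Lemma djost_lim : exists M, forall N w, cmod w <= 1 ->
  cmod (djost N w - cev (dsq (xk 0)) w) <= M * q ^+ N.
Proof.
have [M hM] := tc_lim q01 beta al1; exists (2 * (M / (1 - 1 / 2))) => N w w1.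
have := cev_bound (half01 R) (gb_dsq (hM N)) w1.
have -> : dsq (fun j => tc N j + -1 * xk 0 j) = fun j => dsq (tc N) j + -1 * dsq (xk 0) j.
  by apply/funext => j; rewrite /dsq; ring.
have [Me hMe] := ecoef_bound q01; have [Mt hMt] := tc_bound q01 beta al1.
have g1 : geo (dsq (xk 0)) by eexists; apply: gb_dsq; exact: gb_xk.
have g2 : geo (dsq (tc N)) by eexists; apply: gb_dsq; exact: hMt.
rewrite cevD ?cevZ //; last exact: geoZ.
rewrite rmorphN mulN1r => h; apply: le_trans h _.
by rewrite le_eqVlt; apply/orP; left; apply/eqP; ring.
Qed.

Lemma jost_bound : exists B, forall N w, cmod w <= 1 ->
  [/\ cmod (jost N w) <= B, cmod (djost N w) <= B, cmod (xinf w) <= B & cmod (cev (dsq (xk 0)) w) <= B].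
Proof.
have [Me hMe] := ecoef_bound q01; have [Mt hMt] := tc_bound q01 beta al1.
have e0 := gb_ge0 hMe; have t0 := gb_ge0 (hMt 0%N).
exists (4 * (Me + Mt)) => N w w1.
have hx := gb_xk q01 0 hMe.
have := cev_bound (quarter01 R) (hMt N) w1; have := cev_bound (half01 R) (gb_dsq (hMt N)) w1.
have := cev_bound (quarter01 R) hx w1; have := cev_bound (half01 R) (gb_dsq hx) w1.
have -> : (1 - 1 / 4 : R) = 3 / 4 by lra.
have -> : (1 - 1 / 2 : R) = 1 / 2 by lra.
rewrite /jost /djost /xinf !invf_div !divr1 => h1 h2 h3 h4.
by split; [apply: le_trans h4 _|apply: le_trans h3 _|apply: le_trans h2 _|apply: le_trans h1 _]; lra.
Qed.

Lemma xinf_neq0 w : cmod w <= 1 -> xinf w != 0.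
Proof. exact: (cev_xk_neq0 q01 0). Qed.

Lemma jost_sum N w : cmod w <= 1 ->
  csum_to (fun k => cev (tau k) w * (q ^+ (N * k))%:C) (jost N w).
Proof.
move=> w1; have [M [s [s01 M0 h]]] := tc_tail q01 beta al1.
have [M' [s' [s01' M0' h']]] := tau_bound q01 beta al1.
have gt k : geo (tau k) by apply: gb_quarter_geo (h' k).
move=> e e0; have [N0 hN0] := small_geo (2 * (M / (1 - 1 / 4))) s01 e0.
exists N0 => n /hN0; apply: le_trans.
have gs m : geo (fun j => \sum_(k < m) tau k j * q ^+ (N * k)).
  elim: m => [|m IH].
    exists 0 => j; by rewrite big_ord0 normr0 mul0r.
  have -> : (fun j => \sum_(k < m.+1) tau k j * q ^+ (N * k)) =
      fun j => \sum_(k < m) tau k j * q ^+ (N * k) + q ^+ (N * m) * tau m j.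
    by apply/funext => j; rewrite big_ord_recr /= [tau m j * _]mulrC.
  by apply: geoD => //; exact: geoZ.
have -> : \sum_(k < n) cev (tau k) w * (q ^+ (N * k))%:C =
    cev (fun j => \sum_(k < n) tau k j * q ^+ (N * k)) w.
  elim: n => [|n IH].
    rewrite big_ord0; apply/esym; apply: cseries_eq => e' e0'; exists 0%N => n _.
    by rewrite big1 ?subrr ?cmod0 ?ltW // => i _; rewrite big_ord0 mul0r.
  have -> : (fun j => \sum_(k < n.+1) tau k j * q ^+ (N * k)) =
      fun j => \sum_(k < n) tau k j * q ^+ (N * k) + q ^+ (N * n) * tau n j.
    by apply/funext => j; rewrite big_ord_recr /= [tau n j * _]mulrC.
  rewrite (cevD (gs n) (geoZ _ (gt n)) w1) (cevZ _ (gt n) w1).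
  by rewrite big_ord_recr /= IH [cev (tau n) w * _]mulrC.
have := cev_bound (quarter01 R) (h N n) w1.
have -> : (fun j => tc N j - \sum_(k < n) tau k j * q ^+ (N * k)) =
   fun j => tc N j + -1 * \sum_(k < n) tau k j * q ^+ (N * k).
  by apply/funext => j; rewrite mulN1r.
rewrite cevD ?cevZ //; last exact: geoZ.
rewrite rmorphN mulN1r => hh; apply: le_trans hh _.
by rewrite le_eqVlt; apply/orP; left; apply/eqP; ring.
Qed.

Lemma cev_tau k z : cmod (z ^+ 2) <= 1 ->
  cev (tau k) (z ^+ 2) =
  cev (xk k) (z ^+ 2) * ck alpha%:C beta%:C q%:C z k / (qpoch q q k)%:C.
Proof.
move=> w1; have gc l a : geo a -> geo (cmul q alpha beta l a).
  by move=> ga; elim: l => //= l IH; exact: geo_mul_lin.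
rewrite tauE cevZ //; last exact: gc (geo_xk q01 k).
rewrite fmorphV [RHS]mulrC; congr (_ * _).
have hc l a : geo a -> cev (cmul q alpha beta l a) (z ^+ 2) =
    cev a (z ^+ 2) * ck alpha%:C beta%:C q%:C z l.
  move=> ga; elim: l => [|l IH] /=; first by rewrite /ck big_ord0 mulr1.
  rewrite cev_mul_lin ?IH //; last exact: gc.
  rewrite /ck big_ord_recr /= /Afac /Bfac !rmorphB !rmorphM !rmorphXn /=.
  by ring.
exact: hc (geo_xk q01 k).
Qed.

Lemma qpoch_rmorph (a : R) k : (qpoch a q k)%:C = qpoch a%:C q%:C k.
Proof.
rewrite /qpoch rmorph_prod; apply: eq_bigr => i _.
by rewrite rmorphB rmorphM rmorphXn rmorph1.
Qed.

(** Termwise division: (q w; q)_oo is (q w; q)_k times the factor (q^(k+1) w; q)_oo contained in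
    t_k. *)
Lemma phi21E theta : let w := (Complex (cos theta) (sin theta)) ^+ 2 in
  cmod w <= 1 -> phi21 alpha beta q theta = jost 0 w / xinf w.
Proof.
move=> w w1; apply: cseries_eq.
have := csum_toZ (xinf w)^-1 (jost_sum 0 w1); rewrite [_^-1 * _]mulrC.
apply: eq_csum_to => k; cbv beta; rewrite mul0n expr0 mulr1 /w cev_tau // -/w.
rewrite /xinf (cev_xk_prod q01 0 k w1) expr1 add0n qpoch_rmorph.
have h1 := cev_xk_neq0 q01 k w1.
have h2 : qpoch (q%:C * w) q%:C k != 0.
  have := xinf_neq0 w1; rewrite /xinf (cev_xk_prod q01 0 k w1) expr1 mulf_eq0 negb_or.
  by case/andP.
have h3 : qpoch q%:C q%:C k != 0.
  by rewrite -qpoch_rmorph (inj_eq (@complexI R)) gt_eqF // qpoch_gt0.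
by field; rewrite h1 h2 h3.
Qed.

(** The finite product telescopes to [x k / x (k + n)], and the denominator tends to 1. *)
Lemma qpoch_infE k (y : R) : 0 <= y <= 1 ->
  qpoch_inf (q ^+ k.+1 * y) q = complex.Re (cev (xk k) y%:C).
Proof.
move=> /andP[y0 y1]; have w1 : cmod y%:C <= 1 by rewrite cmodR ger0_norm.
pose x n := complex.Re (cev (xk n) y%:C).
have xE n : cev (xk n) y%:C = (x n)%:C by rewrite /x -cev_real.
have x0 n : x n != 0.
  by rewrite -(inj_eq (@complexI R)) -xE; exact: cev_xk_neq0.
have e n : qpoch (q ^+ k.+1 * y) q n = x k / x (k + n)%N.
  apply: complexI; rewrite qpoch_rmorph !rmorphM fmorphV /= -!xE (cev_xk_prod q01 k n w1).
  by rewrite mulfK // cev_xk_neq0.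
apply: cvg_lim => //; rewrite (funext e) -[X in _ --> X]divr1.
apply: cvgM; first exact: cvg_cst.
apply: cvgV; first exact: oner_neq0.
have [M hM] := xk_to1 q01; apply/cvgrPdist_le => ep ep0.
have [N hN] := small_geo M q01' ep0; exists N => // n /= Nn.
apply: le_trans (hN (k + n)%N (leq_trans Nn (leq_addl _ _))).
by have := hM (k + n)%N _ w1; rewrite xE -(rmorph1 (@real_complex R)) -rmorphB /= cmodR distrC.
Qed.

Lemma psiplusE (n : int) N (x : R) : 0 < x <= 1 -> n + 1 = N%:Z ->
  psiplus alpha beta q n x = x ^ n * complex.Re (jost N (x ^+ 2)%:C).
Proof.
move=> /andP[x0 x1] nN; congr (_ * _).
have y01 : 0 <= x ^+ 2 <= 1 by rewrite exprn_ge0 ?(ltW x0) //= exprn_ile1 // ltW.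
have w1 : cmod (x ^+ 2)%:C <= 1.
  by case/andP: y01 => a b; rewrite cmodR ger0_norm.
apply: etrans (esym (Re_cseries_real (fun k : nat => qpoch_inf (q ^+ k.+1 * x ^+ 2) q
  / qpoch q q k * ck alpha beta q x k * q ^ ((n + 1) * k%:Z)))) _.
congr (complex.Re _); apply: cseries_eq.
apply: eq_csum_to (jost_sum N w1) => k; cbv beta.
have e1 : q ^ ((n + 1) * k%:Z) = q ^+ (N * k) by rewrite nN -PoszM -exprnP.
rewrite e1 qpoch_infE // [RHS]rmorphM; congr (_ * _).
rewrite [(x ^+ 2)%:C]rmorphXn /= cev_tau; last by rewrite -rmorphXn.
rewrite 2!rmorphM fmorphV /= -[in RHS]rmorphXn /= -cev_real.
have -> : (ck alpha beta q x k)%:C = ck alpha%:C beta%:C q%:C x%:C k.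
  rewrite /ck rmorph_prod; apply: eq_bigr => i _.
  by rewrite rmorphB !rmorphM !rmorphD !rmorphM !rmorphXn rmorph1.
by rewrite mulrAC [(x ^+ 2)%:C]rmorphXn.
Qed.

(* Up to the factor |z|^(2N), the Wronskian of psi(z) and its complex conjugate. *)
Definition wronsk z N := complex.Im (z * jost N.+1 (z ^+ 2) * (jost N (z ^+ 2))^*).

Lemma cmodX2 (z : R[i]) : cmod z <= 1 -> cmod (z ^+ 2) <= 1.
Proof. by move=> z1; rewrite cmodX exprn_ile1 ?cmod_ge0. Qed.

Lemma wronsk_lim z : cmod z <= 1 -> exists M, forall N,
  `|complex.Im z * csqabs (xinf (z ^+ 2)) - wronsk z N| <= M * q ^+ N.
Proof.
move=> z1; have w1 := cmodX2 z1; set w := z ^+ 2 in w1 *.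
have [M hM] := jost_lim; have [B hB] := jost_bound.
exists (2 * B * M) => N; rewrite distrC.
have -> : complex.Im z * csqabs (xinf w) = complex.Im (z * xinf w * (xinf w)^*).
  by rewrite /csqabs; case: (z); case: (xinf w) => *; rewrite /=; ring.
rewrite /wronsk -ImN -ImD; apply: le_trans (Im_le_cmod _) _.
rewrite -!mulrA -mulrBr cmodM; apply: le_trans (ler_piMl (cmod_ge0 _) z1) _.
rewrite [2 * _]mulrA; apply: cmod_mul_close.
- by have [] := hB N.+1 w w1.
- by rewrite cmod_conj; have [] := hB N w w1.
- apply: le_trans (hM N.+1 w w1) _; rewrite exprS mulrCA ler_piMl //; last exact: ltW.
  exact: le_trans (cmod_ge0 _) (hM N w w1).
- by rewrite -rmorphB cmod_conj; exact: hM.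
Qed.

Lemma wronsk_step z N : cmod z <= 1 ->
  csqabs z * wronsk z N.+1 = (gtil alpha beta q N)^-1 * csqabs (jost N.+1 (z ^+ 2))
     * (complex.Im z * (csqabs z - 1)) + wronsk z N.
Proof. by move=> z1; apply: wronskian_step; exact: jost_rec (cmodX2 z1). Qed.

(** For |z| = 1 the increment in [wronsk_step] vanishes, so the Wronskian is independent of N and
    equals its limit. *)
Lemma circle_wronskian z : cmod z = 1 ->
  complex.Im (z * jost 1 (z ^+ 2) * (jost 0 (z ^+ 2))^*) = complex.Im z * csqabs (xinf (z ^+ 2)).
Proof.
move=> z1; have z1' : cmod z <= 1 by rewrite z1.
have hc : csqabs z = 1 by rewrite -cmod_sq z1 expr1n.
have e N : wronsk z N = wronsk z 0.
  elim: N => [|N IH]; first by [].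
  rewrite -IH; have := wronsk_step N z1'.
  by rewrite hc mul1r subrr !mulr0 add0r.
have [M hM] := wronsk_lim z1'.
apply/eqP; rewrite -subr_eq0 -normr_eq0; apply/eqP.
apply: (le_geo_eq0 q01') => // N; rewrite distrC -/(wronsk z 0) -(e N); exact: hM.
Qed.

Lemma csqabs_ge0 (x : R[i]) : 0 <= csqabs x.
Proof. by rewrite -cmod_sq exprn_ge0 // cmod_ge0. Qed.

(* If T_0(z^2) = 0, the recurrence keeps wronsk z N <= 0 for all N, but its limit
   Im z * |(q z^2; q)_oo|^2 is positive. *)
Lemma jost0_neq0_Im_pos z : cmod z <= 1 -> 0 < complex.Im z -> jost 0 (z ^+ 2) != 0.
Proof.
move=> z1 zi; apply/eqP => T00.
have zc : 0 < csqabs z.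
  by rewrite lt_neqAle csqabs_ge0 eq_sym csqabs0 andbT; apply: contraTneq zi => ->; rewrite ltxx.
have zc1 : csqabs z <= 1 by rewrite -cmod_sq exprn_ile1 ?cmod_ge0.
have hg N : wronsk z N <= 0.
  elim: N => [|N IH]; first by rewrite /wronsk T00 /= rmorph0 mulr0.
  rewrite -(pmulr_rle0 _ zc) wronsk_step //.
  have h1 : 0 <= (gtil alpha beta q N)^-1 * csqabs (jost N.+1 (z ^+ 2)).
    by rewrite mulr_ge0 ?csqabs_ge0 // invr_ge0 ltW // gtil_gt0.
  have h2 : complex.Im z * (csqabs z - 1) <= 0 by rewrite mulr_ge0_le0 ?subr_le0 //; exact: ltW.
  by have := mulr_ge0_le0 h1 h2; lra.
have [M hM] := wronsk_lim z1; have w1 := cmodX2 z1.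
have h0 : 0 < complex.Im z * csqabs (xinf (z ^+ 2)).
  by rewrite mulr_gt0 // lt_neqAle csqabs_ge0 eq_sym csqabs0 andbT xinf_neq0.
have h02 : 0 < complex.Im z * csqabs (xinf (z ^+ 2)) / 2 by rewrite divr_gt0.
have [N hN] := small_geo M q01' h02.
have := hM N; have := hN N (leqnn N); have := hg N.
rewrite ler_norml => h1 h2 /andP[_ h3]; lra.
Qed.

(** For w = 0 the recurrence would propagate the zero to all N, against the limit (q w; q)_oo.
    Otherwise take a square root z of w: up to sign Im z > 0, unless z is real, and then w lies in
    (0, 1]. *)
Lemma jost0_neq0 w : cmod w <= 1 -> (forall a : R, 0 < a <= 1 -> w != a%:C) -> jost 0 w != 0.
Proof.
move=> w1 hw; have [->|w0] := eqVneq w 0.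
  apply/eqP => e; have w01 : cmod (0 : R[i]) <= 1 by rewrite cmod0.
  have hT N : jost N 0 = 0.
    elim: N => [|N IH]; first exact: e.
    have := jost_rec N w01; rewrite IH mul0r !addr0 mul1r.
    by move=> /esym/eqP; rewrite mulf_eq0 (inj_eq (@complexI R)) invr_eq0 gt_eqF ?gtil_gt0 //= => /eqP.
  have [M hM] := jost_lim; have := xinf_neq0 w01; rewrite -cmod_eq0 => /eqP; apply.
  apply: (le_geo_eq0 q01') (cmod_ge0 _) _ => N.
  by have := hM N 0 w01; rewrite hT sub0r cmodN; apply.
have [z zw] : exists z : R[i], z ^+ 2 = w by exists (sqrtc w); rewrite sqr_sqrtc.
have z1 : cmod z <= 1.
  by move: w1; rewrite -zw cmodX expr_le1 // cmod_ge0.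
have z0 : z != 0 by apply: contraNneq w0 => z0; rewrite -zw z0 expr0n.
rewrite -zw; case: (ltgtP (complex.Im z) 0) => hz.
- rewrite -sqrrN; apply: jost0_neq0_Im_pos; first by rewrite cmodN.
  by rewrite ImN oppr_gt0.
- exact: jost0_neq0_Im_pos.
- have zr : z = (complex.Re z)%:C by apply: complex_ext.
  have r0 : complex.Re z != 0 by rewrite -(inj_eq (@complexI R)) -zr.
  have := hw (complex.Re z ^+ 2); rewrite -zw zr -rmorphXn /= eqxx => /(_ _)/negP h.
  exfalso; apply: h => //; rewrite exprn_even_gt0 //= r0 /=.
  move: z1; rewrite zr cmodR => z1.
  by rewrite -[_ ^+ 2]real_normK ?num_real // exprn_ile1.
Qed.

(* V is the Wronskian of psi and d psi / dz: a double zero would give V 0 = 0, hence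
   V N >= 0 for all N, whereas V N tends to - (q a; q)_oo ^ 2. *)
Lemma jost0_simple (a : R) : 0 < a <= 1 -> jost 0 a%:C = 0 -> djost 0 a%:C != 0.
Proof.
move=> /andP[a0 a1] T00; apply/eqP => dT00.
have w1 : cmod a%:C <= 1 by rewrite cmodR gtr0_norm.
pose t N := complex.Re (jost N a%:C); pose s N := complex.Re (djost N a%:C).
have tE N : jost N a%:C = (t N)%:C by rewrite /t /jost -cev_real.
have sE N : djost N a%:C = (s N)%:C by rewrite /s /djost -cev_real.
pose V N := - (t N * t N.+1) + 2 * a * (t N.+1 * s N - t N * s N.+1).
have r1 N : t N + a * t N.+2 = (gtil alpha beta q N)^-1 * ((1 + a) * t N.+1).
  apply: complexI; have := jost_rec N w1.
  by rewrite !tE !rmorphD !rmorphM !rmorphD rmorph1.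
have r2 N : s N + (t N.+2 + a * s N.+2) =
    (gtil alpha beta q N)^-1 * (s N.+1 + (t N.+1 + a * s N.+1)).
  apply: complexI; have := djost_rec N w1.
  by rewrite !tE !sE !rmorphD !rmorphM !rmorphD !rmorphM.
have Vs N : a * V N.+1 = (1 - a) * (gtil alpha beta q N)^-1 * t N.+1 ^+ 2 + V N.
  exact: derivative_wronskian_step.
have V0 N : 0 <= V N.
  elim: N => [|N IH].
    have -> : V 0%N = 0.
      have e1 : t 0%N = 0 by rewrite /t T00.
      have e2 : s 0%N = 0 by rewrite /s dT00.
      by rewrite /V e1 e2; ring.
    exact: lexx.
  rewrite -(pmulr_rge0 _ a0) Vs addr_ge0 // mulr_ge0 ?sqr_ge0 // mulr_ge0 ?subr_ge0 //.
  by rewrite invr_ge0 ltW // gtil_gt0.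
pose x := complex.Re (xinf a%:C); pose y := complex.Re (cev (dsq (xk 0)) a%:C).
have xE : xinf a%:C = x%:C by rewrite /x /xinf -cev_real.
have yE : cev (dsq (xk 0)) a%:C = y%:C by rewrite /y -cev_real.
have [M1 h1] := jost_lim; have [M2 h2] := djost_lim; have [B hB] := jost_bound.
have t1 N : `|t N - x| <= M1 * q ^+ N.
  by have := h1 N _ w1; rewrite tE xE -rmorphB /= cmodR.
have s1 N : `|s N - y| <= M2 * q ^+ N.
  by have := h2 N _ w1; rewrite sE yE -rmorphB /= cmodR.
have x0 : x != 0 by rewrite -(inj_eq (@complexI R)) -xE xinf_neq0.
clear r1 r2 Vs tE sE xE yE h1 h2 hB T00 dT00.
clearbody t s x y.
have ct : t @ \oo --> x.
  apply/cvgrPdist_le => e e0; have [N hN] := small_geo M1 q01' e0.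
  by exists N => // n /= /hN; apply: le_trans; rewrite distrC.
have cs : s @ \oo --> y.
  apply/cvgrPdist_le => e e0; have [N hN] := small_geo M2 q01' e0.
  by exists N => // n /= /hN; apply: le_trans; rewrite distrC.
have ct' : (fun n => t n.+1) @ \oo --> x by rewrite cvg_shiftS.
have cs' : (fun n => s n.+1) @ \oo --> y by rewrite cvg_shiftS.
have cV : V @ \oo --> - (x * x) + 2 * a * (x * y - x * y).
  apply: cvgD; first by apply: cvgN; exact: cvgM.
  by apply: cvgM; [exact: cvg_cst|apply: cvgB; exact: cvgM].
have : 0 <= - (x * x) + 2 * a * (x * y - x * y).
  by apply: (cvgr_to_ge cV); apply: nearW => N; exact: V0.
rewrite subrr mulr0 addr0 oppr_ge0 leNgt => /negP; apply.
by rewrite -expr2 exprn_even_gt0.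
Qed.

End QValues.

(** * The disc algebra *)

Section DiscAlgebra.
Variable R : realType.
Implicit Types (G H : R[i] -> R[i]) (P : {poly R[i]}) (w r : R[i]).

(** The disc algebra as the uniform closure of the polynomials: identities for monomials then pass
    to the limit. *)
Definition DA G := forall e : R, 0 < e -> exists P, forall w, cmod w <= 1 ->
  cmod (G w - P.[w]) <= e.

Lemma DA_horner P : DA (fun w => P.[w]).
Proof. by move=> e e0; exists P => w _; rewrite subrr cmod0 ltW. Qed.

Lemma eq_DA G H : (forall w, cmod w <= 1 -> G w = H w) -> DA G -> DA H.
Proof. by move=> eGH hG e /hG [P hP]; exists P => w w1; rewrite -eGH ?hP. Qed.

Lemma DA_limit G : (forall e : R, 0 < e -> exists2 H, DA H &
  forall w, cmod w <= 1 -> cmod (G w - H w) <= e) -> DA G.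
Proof.
move=> h e e0; have e2 : 0 < e / 2 by rewrite divr_gt0.
have [H hH1 hH2] := h _ e2; have [P hP] := hH1 _ e2; exists P => w w1.
apply: le_trans (cmod_tri _ (H w) _) _.
by rewrite (splitr e) lerD ?hH2 ?hP.
Qed.

Lemma horner_bound P : exists B, forall w, cmod w <= 1 -> cmod P.[w] <= B.
Proof.
exists (\sum_(i < size P) cmod P`_i) => w w1; rewrite horner_coef.
apply: le_trans (cmod_sum _ _ _) _; apply: ler_sum => i _.
by rewrite cmodM cmodX ler_piMr ?cmod_ge0 // exprn_ile1 // cmod_ge0.
Qed.

Lemma DA_bounded G : DA G -> exists2 B, 0 < B & forall w, cmod w <= 1 -> cmod (G w) <= B.
Proof.
move=> /(_ 1 ltr01) [P hP]; have [B hB] := horner_bound P.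
have B0 : 0 <= B by apply: le_trans (hB 0 _); rewrite ?cmod_ge0 ?cmod0.
exists (1 + B); first by rewrite ltr_pwDl.
move=> w w1; rewrite -[G w](subrK P.[w]).
by apply: le_trans (cmodD _ _) _; rewrite lerD ?hP ?hB.
Qed.

Lemma DA_M G H : DA G -> DA H -> DA (fun w => G w * H w).
Proof.
move=> hG hH; have [B B0 hB] := DA_bounded hG; have [C C0 hC] := DA_bounded hH.
move=> e e0.
(* The minimum with 1 keeps the polynomial approximating G bounded by B + 1. *)
have e1 : 0 < Num.min 1 (e / (2 * (C + 1))).
  by rewrite lt_min ltr01 divr_gt0 // mulr_gt0 // ltr_pwDr // ltW.
have e2 : 0 < e / (2 * (B + 1)) by rewrite divr_gt0 // mulr_gt0 // ltr_pwDr // ltW.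
have [P hP] := hG _ e1; have [Q hQ] := hH _ e2; exists (P * Q) => w w1; rewrite hornerM.
have -> : G w * H w - P.[w] * Q.[w] = (G w - P.[w]) * H w + P.[w] * (H w - Q.[w]) by ring.
apply: le_trans (cmodD _ _) _; rewrite !cmodM (splitr e).
have hP' : cmod P.[w] <= B + 1.
  rewrite -[P.[w]](subKr (G w)); apply: le_trans (cmodD _ _) _; rewrite cmodN lerD ?hB //.
  by apply: le_trans (hP w w1) _; rewrite ge_min lexx.
have hP2 : cmod (G w - P.[w]) <= e / (2 * (C + 1)).
  by apply: le_trans (hP w w1) _; rewrite ge_min lexx orbT.
apply: lerD.
- have := ler_pM (cmod_ge0 _) (cmod_ge0 _) hP2 (hC w w1) => h.
  apply: le_trans h _.
  have -> : e / 2 = e / (2 * (C + 1)) * (C + 1).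
    by field; rewrite gt_eqF // ltr_pwDr // ltW.
  by rewrite ler_wpM2l ?lerDl // divr_ge0 ?(ltW e0) // mulr_ge0 // addr_ge0 // ltW.
- have := ler_pM (cmod_ge0 _) (cmod_ge0 _) hP' (hQ w w1) => h.
  apply: le_trans h _; rewrite le_eqVlt; apply/orP; left; apply/eqP.
  by field; rewrite gt_eqF // ltr_pwDr // ltW.
Qed.

Lemma DA_sq G : DA G -> DA (fun w => G (w ^+ 2)).
Proof.
move=> hG e /hG [P hP]; exists (P \Po 'X^2) => w w1.
by rewrite horner_comp hornerXn hP // cmodX exprn_ile1 // cmod_ge0.
Qed.

Lemma DA_cev (a : nat -> R) : geo a -> DA (cev a).
Proof.
move=> [M hM] e e0.
have [N hN] := small_geo (2 * (M / (1 - 1 / 2))) (half01 R) e0.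
exists (\sum_(j < N) (a j)%:C *: 'X^j) => w w1; rewrite horner_sum.
under eq_bigr do rewrite hornerZ hornerXn.
apply: le_trans (cev_tail (half01 R) hM w1 N) _; apply: le_trans (hN N (leqnn _)).
by rewrite le_eqVlt; apply/orP; left; apply/eqP; ring.
Qed.

(** The approximants are partial sums of the geometric series in w / r, which converges uniformly
    since |r| > 1. *)
Lemma DA_geom r : 1 < cmod r -> DA (fun w => (w - r)^-1).
Proof.
move=> r1; have r0 : 0 < cmod r by apply: lt_trans r1.
have rn0 : r != 0 by rewrite -cmod_gt0.
have s01 : 0 <= (cmod r)^-1 < 1 by rewrite invr_ge0 ltW //= invf_lt1.
move=> e e0; have [N hN] := small_geo (cmod r - 1)^-1 s01 e0.
exists (\sum_(j < N) (- r^-1 ^+ j.+1) *: 'X^j) => w w1; rewrite horner_sum.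
under eq_bigr do rewrite hornerZ hornerXn.
have wr : 0 < cmod (w - r).
  rewrite cmod_gt0 subr_eq0; apply: contraTneq r1 => <-; by rewrite -leNgt.
have wr0 : w - r != 0 by rewrite -cmod_gt0.
have -> : (w - r)^-1 - \sum_(j < N) - r^-1 ^+ j.+1 * w ^+ j = r^-1 ^+ N * w ^+ N / (w - r).
  elim: N {hN} => [|N IH]; first by rewrite big_ord0 subr0 !expr0 !mul1r.
  rewrite big_ord_recr /= opprD addrA IH !exprS; field.
  by rewrite rn0 wr0.
rewrite !cmodM !cmodX !cmodV; apply: le_trans (hN N (leqnn _)).
rewrite mulrC; apply: ler_pM; rewrite ?invr_ge0 ?cmod_ge0 ?mulr_ge0 ?exprn_ge0 ?invr_ge0 ?cmod_ge0 //.
  rewrite lef_pV2 ?posrE ?subr_gt0 //; rewrite cmodB.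
  have := cmodD (r - w) w; rewrite subrK => h; lra.
by rewrite ler_piMr ?exprn_ge0 ?invr_ge0 ?cmod_ge0 // exprn_ile1 // cmod_ge0.
Qed.

Lemma DA_invpoly P : (forall w, cmod w <= 1 -> P.[w] != 0) -> DA (fun w => P.[w]^-1).
Proof.
move=> hP; have [rs eP] := closed_field_poly_normal P.
have hr r : r \in rs -> 1 < cmod r.
  move=> rrs; rewrite ltNge; apply/negP => /hP /eqP; apply.
  rewrite eP hornerZ horner_prod (big_rem r) //=.
  by rewrite hornerXsubC subrr mul0r mulr0.
have : DA (fun w => \prod_(r <- rs) (w - r)^-1).
  elim: rs {eP} hr => [|r rs IH] hr.
    by apply: eq_DA (DA_horner 1) => w _; rewrite big_nil hornerC.
  have h := DA_M (DA_geom (hr r (mem_head _ _)))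
    (IH (fun r' h => hr r' (mem_behead (s := r :: rs) h))).
  by apply: eq_DA h => w _; rewrite big_cons.
move=> h; apply: eq_DA (DA_M (DA_horner (lead_coef P)^-1%:P) h) => w _.
rewrite hornerC [in RHS]eP hornerZ horner_prod invfM -prodfV; congr (_ * _).
by apply: eq_bigr => r _; rewrite hornerXsubC.
Qed.

(* Approximate G by a polynomial; it has no root in the disc, so its inverse is a product
   of geometric series. *)
Lemma DA_inv G (d : R) : DA G -> 0 < d -> (forall w, cmod w <= 1 -> d <= cmod (G w)) ->
  DA (fun w => (G w)^-1).
Proof.
move=> hG d0 hd; apply: DA_limit => e e0.
(* The first bound keeps |P| above d / 2; the second makes |P - G| / |G P| at most e. *)
have e1 : 0 < Num.min (d / 2) (e * (d * (d / 2))).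
  by rewrite lt_min divr_gt0 //= mulr_gt0 // mulr_gt0 // divr_gt0.
have [P hP] := hG _ e1.
have hP2 w : cmod w <= 1 -> d / 2 <= cmod P.[w].
  move=> w1; have := hP w w1; rewrite le_min => /andP[h _].
  have := hd w w1; have := cmodD (G w - P.[w]) P.[w]; rewrite subrK; lra.
have hG0 w : cmod w <= 1 -> 0 < cmod (G w) by move=> w1; apply: lt_le_trans (hd w w1).
have hP0 w : cmod w <= 1 -> 0 < cmod P.[w].
  by move=> w1; apply: lt_le_trans (hP2 w w1); rewrite divr_gt0.
exists (fun w => P.[w]^-1).
  by apply: DA_invpoly => w w1; rewrite -cmod_gt0 hP0.
move=> w w1; have g0 : G w != 0 by rewrite -cmod_gt0 hG0.
have p0 : P.[w] != 0 by rewrite -cmod_gt0 hP0.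
have -> : (G w)^-1 - P.[w]^-1 = (P.[w] - G w) / (G w * P.[w]) by field; rewrite g0 p0.
rewrite cmodM cmodV cmodM ler_pdivrMr; last by rewrite mulr_gt0 ?hG0 ?hP0.
rewrite cmodB; have := hP w w1; rewrite le_min => /andP[_ h]; apply: le_trans h _.
rewrite ler_pM2l //; apply: ler_pM; [exact: ltW| |exact: hd|exact: hP2].
by rewrite ltW // divr_gt0.
Qed.

(** A Lipschitz function attains its minimum on the compact disc; the disc is viewed inside [R * R],
    where compactness comes from a product of segments. *)
Lemma cev_lower M (a : nat -> R) : gb (1 / 4) M a ->
  (forall w, cmod w <= 1 -> cev a w != 0) ->
  exists2 d : R, 0 < d & forall w, cmod w <= 1 -> d <= cmod (cev a w).
Proof.
move=> ha h0.
pose A := [set p : R * R | p.1 ^+ 2 + p.2 ^+ 2 <= 1].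
have AE (p : R * R) : A p <-> cmod (Complex p.1 p.2) <= 1.
  have -> : (cmod (Complex p.1 p.2) <= 1) = (p.1 ^+ 2 + p.2 ^+ 2 <= 1).
    by rewrite -ler_sqr ?nnegrE ?cmod_ge0 // cmod_sq expr1n.
  by [].
have cA : compact A.
  have cs : compact (`[(-1 : R), 1] `*` `[(-1 : R), 1]) by apply: compact_setX; exact: segment_compact.
  apply: subclosed_compact cs _ => //.
    apply: (@closed_comp _ _ (fun p : R * R => p.1 ^+ 2 + p.2 ^+ 2) [set x | x <= 1]).
      move=> p _; apply: cvgD; (apply: (@cvg_comp _ _ _ _ (fun x : R => x ^+ 2)); last exact: exprn_continuous).
        exact: cvg_fst.
      exact: cvg_snd.
    exact: closed_le.
  move=> [x y]; rewrite /A /= => hxy; rewrite !in_itv /=.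
  have hx : `|x| <= 1 by rewrite -ler_sqr ?nnegrE // real_normK ?num_real // expr1n; have := sqr_ge0 y; lra.
  have hy : `|y| <= 1 by rewrite -ler_sqr ?nnegrE // real_normK ?num_real // expr1n; have := sqr_ge0 x; lra.
  by rewrite -!ler_norml.
have A0 : A !=set0 by exists (0, 0); rewrite /A /= expr0n addr0.
pose f (p : R * R) := cmod (cev a (Complex p.1 p.2)).
have cf : {within A, continuous f}.
  apply/subspace_continuousP => x Ax; apply/cvgrPdist_le => e e0.
  rewrite near_withinE; have M0 := gb_ge0 ha.
  (* The Lipschitz constant is 2 M, and distance d in each coordinate gives modulus at most 2 d; the
     added 1 covers M = 0. *)
  pose d := e / (4 * M + 1).
  have d0 : 0 < d by rewrite divr_gt0 // ltr_wpDl // mulr_ge0.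
  near=> y; move=> Ay.
  have [h1 h2] : ball x d y by near: y; exact: nbhsx_ballx.
  rewrite /ball /= in h1 h2.
  have hl := cev_lipschitz ha ((AE x).1 Ax) ((AE y).1 Ay).
  have : `|f x - f y| <= cmod (cev a (Complex x.1 x.2) - cev a (Complex y.1 y.2)).
    exact: cmod_dist.
  move=> hf; apply: le_trans hf _; apply: le_trans hl _.
  have hc := cmod_le_ReIm (Complex x.1 x.2 - Complex y.1 y.2).
  rewrite /= in hc.
  have hc2 : cmod (Complex x.1 x.2 - Complex y.1 y.2) <= 2 * d.
    apply: le_trans hc _; rewrite (_ : 2 * d = d + d); last by ring.
    by apply: lerD; apply: ltW.
  apply: le_trans (ler_wpM2l _ hc2) _; first by rewrite mulr_ge0.
  rewrite /d (_ : 2 * M * (2 * (e / (4 * M + 1))) = e * (4 * M / (4 * M + 1))); last by ring.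
  rewrite ler_piMr ?(ltW e0) // ler_pdivrMr ?mul1r ?lerDl //.
  by rewrite ltr_wpDl // mulr_ge0.
have [c cA' hc] := compact_EVT_min A0 cA cf.
exists (f c).
  by rewrite /f cmod_gt0 h0 //; apply/AE; rewrite inE in cA'.
move=> [x y] w1; have := hc (x, y); rewrite /f /=; apply.
by rewrite inE; apply/AE.
Unshelve. all: by end_near. Qed.

End DiscAlgebra.

(** * Integration over the half circle *)

Section HalfCircle.
Variable R : realType.
Implicit Types (h k : R -> R) (G : R -> R[i]).

Definition I0 h : R := Rintegral lebesgue_measure `[0, pi] h.

Lemma I0_integrable h : continuous h ->
  lebesgue_measure.-integrable `[0, pi : R] (EFin \o h).
Proof.
move=> ch; apply: continuous_compact_integrable; first exact: segment_compact.
exact: continuous_subspaceT.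
Qed.

Lemma I0D h k : continuous h -> continuous k -> I0 (fun t => h t + k t) = I0 h + I0 k.
Proof. by move=> ch ck; apply: RintegralD => //; exact: I0_integrable. Qed.

Lemma I0Z c h : continuous h -> I0 (fun t => c * h t) = c * I0 h.
Proof. by move=> ch; apply: RintegralZl => //; exact: I0_integrable. Qed.

Lemma I0_cst c : I0 (fun=> c) = c * pi.
Proof.
rewrite /I0 Rintegral_cst //= lebesgue_measure_itv /= lte_fin pi_gt0 /=.
by rewrite subr0.
Qed.

Lemma I0_sum (n : nat) (F : nat -> R -> R) : (forall i, continuous (F i)) ->
  I0 (fun t => \sum_(i < n) F i t) = \sum_(i < n) I0 (F i) /\
  continuous (fun t => \sum_(i < n) F i t).
Proof.
move=> cF; elim: n => [|n [IH cn]].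
  split; first by under eq_fun do rewrite big_ord0; rewrite I0_cst mul0r big_ord0.
  by under eq_fun do rewrite big_ord0; move=> x; exact: cvg_cst.
have e : (fun t => \sum_(i < n.+1) F i t) = fun t => \sum_(i < n) F i t + F n t.
  by apply/funext => t; rewrite big_ord_recr.
rewrite e; split; first by rewrite I0D // IH big_ord_recr.
by move=> x; apply: cvgD; [exact: cn|exact: cF].
Qed.

Lemma I0_bound h e : continuous h -> (forall t, `|h t| <= e) -> `|I0 h| <= e * pi.
Proof.
move=> ch he; rewrite -I0_cst.
apply: le_trans (le_normr_Rintegral _ _) _ => //; first exact: I0_integrable.
have i1 : continuous (fun t => `|h t|) by move=> x; apply: cvg_norm; exact: ch.
have i2 : continuous (fun _ : R => e) by move=> x; exact: cvg_cst.
by apply: (le_Rintegral _ (I0_integrable i1) (I0_integrable i2) (fun t _ => he t)).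
Qed.

(** Nothing is asked of h at 0 and pi, where both the sine and 2phi1 may vanish; measurability of h
    is inherited from k on the open interval, and the endpoints are null. *)
Lemma I0_eq_oo h k : continuous k -> (forall t, 0 < t < pi -> h t = k t) -> I0 h = I0 k.
Proof.
move=> ck hk.
have ik : lebesgue_measure.-integrable `]0, pi : R[ (EFin \o k).
  by apply: integrableS (I0_integrable ck) => //; exact: subset_itvW.
have ih : lebesgue_measure.-integrable `]0, pi : R[ (EFin \o h).
  apply: eq_integrable ik => // t; rewrite inE /= in_itv /= => /hk e.
  by rewrite /= e.
have hc (f : R -> R) : lebesgue_measure.-integrable `]0, pi : R[ (EFin \o f) ->
    I0 f = Rintegral lebesgue_measure `]0, pi[ f.
  move=> /measurable_int mf; rewrite /I0 /Rintegral; congr fine.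
  rewrite integral_itv_bndo_bndc // integral_itv_obnd_cbnd //.
  exact/measurable_realfun.emeasurable_fun_itv_bndo_bndcP.
rewrite !hc //; apply: eq_Rintegral => t; rewrite inE /= in_itv /=; exact: hk.
Qed.

Definition ccont G :=
  continuous (fun t => complex.Re (G t)) /\ continuous (fun t => complex.Im (G t)).

Lemma ccont_cst c : ccont (fun=> c).
Proof. by split=> x; exact: cvg_cst. Qed.

Lemma ccontM G H : ccont G -> ccont H -> ccont (fun t => G t * H t).
Proof.
move=> [g1 g2] [h1 h2]; split.
  rewrite (funext (fun t => ReM (G t) (H t))) => x.
  by apply: cvgB; apply: cvgM; [exact: g1|exact: h1|exact: g2|exact: h2].
rewrite (funext (fun t => ImM (G t) (H t))) => x.
by apply: cvgD; apply: cvgM; [exact: g1|exact: h2|exact: g2|exact: h1].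
Qed.

Lemma ccontD G H : ccont G -> ccont H -> ccont (fun t => G t + H t).
Proof.
move=> [g1 g2] [h1 h2]; split.
  rewrite (funext (fun t => ReD (G t) (H t))) => x.
  by apply: cvgD; [exact: g1|exact: h1].
rewrite (funext (fun t => ImD (G t) (H t))) => x.
by apply: cvgD; [exact: g2|exact: h2].
Qed.

Lemma ccontV G : (forall t, G t != 0) -> ccont G -> ccont (fun t => (G t)^-1).
Proof.
move=> G0 [g1 g2].
have c2 : continuous (fun t => csqabs (G t)).
  by move=> x; apply: cvgD; apply: cvgM; by [exact: g1|exact: g2].
have cV : continuous (fun t => (csqabs (G t))^-1).
  by move=> x; apply: cvgV; [rewrite csqabs0|exact: c2].
split.
  rewrite (funext (fun t => ReV (G t))) => x.
  by apply: cvgM; [exact: g1|exact: cV].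
rewrite (funext (fun t => ImV (G t))) => x.
by apply: cvgM; [apply: cvgN; exact: g2|exact: cV].
Qed.

Lemma ccontX G n : ccont G -> ccont (fun t => G t ^+ n).
Proof.
move=> cG; elim: n => [|n IH].
  by under eq_fun do rewrite expr0; exact: ccont_cst.
by under eq_fun do rewrite exprS; exact: ccontM.
Qed.

Lemma ccont_limit G : (forall e : R, 0 < e -> exists2 F, ccont F &
  forall t, cmod (G t - F t) <= e) -> ccont G.
Proof.
have key (f : R -> R) : (forall e : R, 0 < e -> exists2 g, continuous g &
    forall t, `|f t - g t| <= e) -> continuous f.
  move=> hf x; apply/cvgrPdist_le => e e0.
  have e3 : 0 < e / 3 by rewrite divr_gt0.
  have [g cg hg] := hf _ e3.
  have /cvgrPdist_le /(_ _ e3) := cg x; apply: filterS => y hy.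
  have := hg x; have := hg y; have := ler_normD (f x - g x) (g x - g y).
  have := ler_normD (f x - g x + (g x - g y)) (g y - f y).
  rewrite [`|g y - f y|]distrC (_ : f x - g x + (g x - g y) + (g y - f y) = f x - f y); last by ring.
  lra.
move=> hG; split; apply: key => e e0; have [F [c1 c2] hF] := hG e e0.
- exists (fun t => complex.Re (F t)) => // t; rewrite -ReN -ReD.
  exact: le_trans (Re_le_cmod _) (hF t).
- exists (fun t => complex.Im (F t)) => // t; rewrite -ImN -ImD.
  exact: le_trans (Im_le_cmod _) (hF t).
Qed.

Definition cis (t : R) : R[i] := Complex (cos t) (sin t).

Lemma ccont_cis : ccont cis.
Proof. by split; [exact: continuous_cos|exact: continuous_sin]. Qed.

Lemma cmod_cis t : cmod (cis t) = 1.
Proof.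
apply/eqP; rewrite -(@eqrXn2 _ 2) ?cmod_ge0 // cmod_sq /csqabs /= cos2Dsin2 expr1n //.
Qed.

Lemma cis_neq0 t : cis t != 0.
Proof. by rewrite -cmod_gt0 cmod_cis. Qed.

Lemma cis_conj t : (cis t)^* = (cis t)^-1.
Proof.
apply: (mulfI (cis_neq0 t)); rewrite divff ?cis_neq0 //.
apply: complex_ext; rewrite /= ?mulrN ?opprK -?expr2 ?cos2Dsin2 //.
by rewrite [sin t * _]mulrC addNr.
Qed.

Lemma cisX t n : cis t ^+ n = cis (n%:R * t).
Proof.
elim: n => [|n IH].
  by rewrite expr0 mul0r /cis cos0 sin0.
rewrite exprS IH -natr1 mulrDl mul1r addrC /cis cosD sinD.
by apply: complex_ext => //=; ring.
Qed.

Lemma DA_ccont (G : R[i] -> R[i]) : DA G -> ccont (fun t => G (cis t)).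
Proof.
move=> hG; apply: ccont_limit => e /hG [P hP].
exists (fun t => P.[cis t]); last by move=> t; apply: hP; rewrite cmod_cis.
elim/poly_ind: P {hP} => [|P c IH].
  by under eq_fun do rewrite horner0; exact: ccont_cst.
under eq_fun do rewrite hornerMXaddC; apply: ccontD; last exact: ccont_cst.
by apply: ccontM => //; exact: ccont_cis.
Qed.

Lemma I0_cisX n : I0 (fun t => complex.Re (cis t ^+ n)) = pi * (n == 0%N)%:R.
Proof.
case: n => [|n].
  under eq_fun do rewrite expr0.
  by rewrite I0_cst mulr1 mul1r.
rewrite mulr0; under eq_fun do rewrite cisX /=.
set N : R := n.+1%:R; have N0 : N != 0 by rewrite pnatr_eq0.
pose F := N^-1 \*: (@sin R \o (N \*: id)).
have sd (x : R) : is_derive x (1 : R) F (cos (N * x)).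
  have d1 : is_derive x (1 : R) (N \*: (@id R)) (N *: (1 : R)) by exact: is_deriveZ.
  have d2 := is_derive1_comp (is_derive_sin ((N \*: (@id R)) x)) d1.
  have d3 : is_derive x (1 : R) F (N^-1 *: (cos ((N \*: (@id R)) x) * (N *: (1 : R)))).
    exact: is_deriveZ.
  apply: is_derive_eq d3 _.
  by rewrite /= /GRing.scale /= mulr1 mulrC mulfK.
have cF : continuous F.
  by move=> x; apply/differentiable_continuous/derivable1_diffP; exact: ex_derive.
have cc : continuous (fun t : R => cos (N * t)).
  move=> x; apply: continuous_comp; last exact: continuous_cos.
  by apply: cvgM; [exact: cvg_cst|exact: cvg_id].
rewrite /I0 /Rintegral (@continuous_FTC2 R _ F) ?pi_gt0 //.
(* The boundary term sin (N pi) is read off as the imaginary part of a power of -1. *)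
- rewrite /F /= /GRing.scale /= mulr0 sin0 mulr0 subr0 -[sin _]/(complex.Im (cis (N * pi))).
  rewrite -cisX /cis cospi sinpi -[Complex _ _]/((-1)%:C) -rmorphXn /= mulr0 //.
- exact: continuous_subspaceT.
- split.
  + by move=> x _; exact: ex_derive.
  + by apply: cvg_at_right_filter; exact: cF.
  + by apply: cvg_at_left_filter; exact: cF.
- by move=> x _; rewrite derive1E; exact: derive_val.
Qed.

End HalfCircle.

(** * Residues *)

Section Residues.
Variable R : realType.
Implicit Types (G H A : R[i] -> R[i]) (a s : R).

(** Equivalent to real Taylor coefficients. On such functions the real part is even in theta, so
    half of the circle determines the mean. *)
Definition csym G := forall w, cmod w <= 1 -> G w^* = (G w)^*.

Lemma Re_monomial (c w : R[i]) n :
  (complex.Re c)%:C * w ^+ n = (c * w ^+ n + conjc (c * conjc w ^+ n)) / 2.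
Proof. by rewrite rmorphM rmorphXn /= conjcK -mulrDl ReJ_add mulrAC. Qed.

Lemma cmod_half (x y u : R[i]) (e : R) : cmod (x - y) <= e -> cmod (conjc x - u) <= e ->
  cmod (x - (y + conjc u) / 2) <= e.
Proof.
move=> h1 h2; have -> : x - (y + conjc u) / 2 = ((x - y) + conjc (conjc x - u)) / 2.
  by rewrite rmorphB /= conjcK; field.
rewrite cmodM cmodV (_ : cmod 2 = 2); last by rewrite -(rmorph_nat (real_complex R) 2) cmodR normr_nat.
rewrite ler_pdivrMr //; apply: le_trans (cmodD _ _) _; rewrite cmod_conj; lra.
Qed.

(** Taking real parts of the coefficients of P amounts to averaging P(w) with the conjugate of
    P(conj w); by symmetry of G both are within e of G w. *)
Lemma DA_real G : DA G -> csym G -> forall e : R, 0 < e ->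
  exists n (c : nat -> R), forall w, cmod w <= 1 ->
    cmod (G w - \sum_(i < n) (c i)%:C * w ^+ i) <= e.
Proof.
move=> hG sG e e0; have [P hP] := hG e e0.
exists (size P), (fun i => complex.Re P`_i) => w w1.
have w1' : cmod w^* <= 1 by rewrite cmod_conj.
have -> : \sum_(i < size P) (complex.Re P`_i)%:C * w ^+ i = (P.[w] + conjc P.[conjc w]) / 2.
  rewrite !horner_coef rmorph_sum -big_split /= mulr_suml; apply: eq_bigr => i _.
  exact: Re_monomial.
apply: cmod_half; first exact: hP.
by rewrite -(sG w w1); exact: hP.
Qed.

(** Both sides are Lipschitz in G for the supremum norm on the disc, so agreement on real
    polynomials suffices. It is used with the kernel 1 and with the kernel of a pole. *)
Lemma half_circle_ext (kap : R -> R[i]) (C CF : R) (F : (R[i] -> R[i]) -> R) :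
  ccont kap -> (forall t, cmod (kap t) <= C) ->
  (forall G H e, (forall w, cmod w <= 1 -> cmod (G w - H w) <= e) ->
     `|F G - F H| <= CF * e) ->
  (forall n (c : nat -> R), F (fun w => \sum_(i < n) (c i)%:C * w ^+ i) =
     \sum_(i < n) c i * I0 (fun t => complex.Re (cis t ^+ i * kap t))) ->
  forall G, DA G -> csym G -> I0 (fun t => complex.Re (G (cis t) * kap t)) = F G.
Proof.
move=> ck kC hF hp G hG sG.
have C0 : 0 <= C by apply: le_trans (kC 0); exact: cmod_ge0.
have CF0 : 0 <= CF.
  have h (w : R[i]) : cmod w <= 1 -> cmod (G w - G w) <= 1.
    by move=> _; rewrite subrr cmod0.
  by have := hF _ _ _ h; rewrite mulr1 subrr normr0.
apply/eqP; rewrite -subr_eq0 -normr_eq0 eq_le normr_ge0 andbT.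
apply/ler_addgt0Pl => e e0; rewrite addr0.
have D0 : 0 < C * pi + CF + 1.
  by rewrite ltr_wpDl // addr_ge0 // mulr_ge0 // ltW // pi_gt0.
pose e' := e / (C * pi + CF + 1); have e'0 : 0 < e' by rewrite divr_gt0.
have [n [c hc]] := DA_real hG sG e'0.
pose H w := \sum_(i < n) (c i)%:C * w ^+ i.
have cG : ccont (fun t => G (cis t) * kap t) by apply: ccontM => //; exact: DA_ccont.
have ci i : ccont (fun t => cis t ^+ i * kap t).
  by apply: ccontM => //; apply: ccontX; exact: ccont_cis.
have cci i : continuous (fun t => c i * complex.Re (cis t ^+ i * kap t)).
  by move=> x; apply: cvgM; [exact: cvg_cst|apply: (ci i).1].
have eH : (fun t => complex.Re (H (cis t) * kap t)) =
    fun t => \sum_(i < n) c i * complex.Re (cis t ^+ i * kap t).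
  apply/funext => t; rewrite /H mulr_suml Re_sum; apply: eq_bigr => i _.
  by rewrite -mulrA Re_scale.
have [sI sc] := I0_sum n cci.
have cH : continuous (fun t => complex.Re (H (cis t) * kap t)) by rewrite eH.
have IH : I0 (fun t => complex.Re (H (cis t) * kap t)) = F H.
  rewrite eH sI hp; apply: eq_bigr => i _; rewrite I0Z //; exact: (ci i).1.
have h1 : `|I0 (fun t => complex.Re (G (cis t) * kap t)) -
    I0 (fun t => complex.Re (H (cis t) * kap t))| <= (e' * C) * pi.
  rewrite -[X in _ - X]mul1r -mulNr -I0Z; last exact: cH.
  rewrite -I0D; [|exact: cG.1|]; last first.
    by move=> x; apply: cvgM; [exact: cvg_cst|exact: cH].
  apply: I0_bound.
    move=> x; apply: cvgD; first exact: cG.1.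
    by apply: cvgM; [exact: cvg_cst|exact: cH].
  move=> t; rewrite mulN1r -ReN -ReD -mulNr -mulrDl.
  apply: le_trans (Re_le_cmod _) _; rewrite cmodM ler_pM ?cmod_ge0 //.
  by apply: hc; rewrite cmod_cis.
have h2 := hF _ _ _ hc; rewrite -/H in h2.
rewrite -[_ - F G](subrKA (F H)) -{1}IH; apply: le_trans (ler_normD _ _) _.
rewrite [`|F H - _|]distrC.
have : e' * C * pi + CF * e' <= e.
  rewrite (_ : _ + _ = (C * pi + CF) * e'); last by ring.
  rewrite /e' mulrCA ler_piMr ?(ltW e0) // ler_pdivrMr // mul1r lerDl //.
by apply: le_trans; rewrite lerD.
Qed.

Lemma mean_value G : DA G -> csym G ->
  I0 (fun t => complex.Re (G (cis t))) = pi * complex.Re (G 0).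
Proof.
move=> hG sG.
have -> : (fun t => complex.Re (G (cis t))) = fun t => complex.Re (G (cis t) * 1).
  by apply/funext => t; rewrite mulr1.
apply: (@half_circle_ext (fun=> 1) 1 pi (fun G => pi * complex.Re (G 0))) => //.
- exact: ccont_cst.
- by move=> t; rewrite cmod1.
- move=> G' H e h; rewrite -mulrBr normrM gtr0_norm ?pi_gt0 // ler_pM2l ?pi_gt0 //.
  by rewrite -ReN -ReD; apply: le_trans (Re_le_cmod _) _; apply: h; rewrite cmod0.
- move=> n c; rewrite Re_sum mulr_sumr; apply: eq_bigr => i _.
  under [in RHS]eq_fun do rewrite mulr1.
  rewrite I0_cisX Re_scale mulrCA; congr (_ * (_ * _)).
  by rewrite expr0n; case: (_ == _).
Qed.

Lemma csym_M G H : csym G -> csym H -> csym (fun w => G w * H w).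
Proof. by move=> g h w w1; rewrite rmorphM /= g ?h. Qed.

Lemma csym_V G : csym G -> csym (fun w => (G w)^-1).
Proof. by move=> g w w1; rewrite g // fmorphV. Qed.

Lemma DA_id : DA (@id R[i]).
Proof. by apply: eq_DA (DA_horner 'X) => w _; rewrite hornerX. Qed.

Lemma DA_X n : DA (fun w : R[i] => w ^+ n).
Proof. by apply: eq_DA (DA_horner 'X^n) => w _; rewrite hornerXn. Qed.

Lemma csym_X n : csym (fun w : R[i] => w ^+ n).
Proof. by move=> w _; rewrite rmorphXn. Qed.

Lemma conj_one_sub (a : R) (w : R[i]) :
  1 - a%:C * conjc w ^+ 2 = conjc (1 - a%:C * w ^+ 2).
Proof. by rewrite rmorphB rmorphM rmorphXn rmorph1 /= oppr0. Qed.

Section Pole.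
Variables s a : R.
Hypothesis s01 : 0 < s < 1.
Hypothesis saE : s ^+ 2 = a.
Let s0 : 0 < s. Proof. by case/andP: s01. Qed.
Let a0 : 0 < a. Proof. by rewrite -saE exprn_gt0. Qed.
Let a1 : a < 1.
Proof. by rewrite -saE exprn_ilt1 //; [exact: ltW|case/andP: s01]. Qed.

Let geomk w := (1 - a%:C * w ^+ 2)^-1.

Lemma one_sub_azz w : cmod w <= 1 -> 1 - a <= cmod (1 - a%:C * w ^+ 2).
Proof.
move=> w1; have := cmodD (1 - a%:C * w ^+ 2) (a%:C * w ^+ 2); rewrite subrK cmod1.
have : cmod (a%:C * w ^+ 2) <= a.
  rewrite cmodM cmodR gtr0_norm // ler_piMr ?(ltW a0) // cmodX.
  by rewrite exprn_ile1 // cmod_ge0.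
by move=> h1 h2; lra.
Qed.

Let DA_geomk : DA geomk.
Proof.
have h1 : 0 < 1 - a by rewrite subr_gt0.
apply: (DA_inv _ h1 one_sub_azz).
apply: eq_DA (DA_horner (1 - a%:C *: 'X^2)) => w _.
by rewrite !hornerE.
Qed.

Let csym_geomk : csym geomk.
Proof.
by move=> w w1; rewrite /geomk fmorphV /= -conj_one_sub.
Qed.

(* On the circle the kernel w / (w - a) is the conjugate of a function of the disc algebra. *)
Let kap t := cis t ^+ 2 / (cis t ^+ 2 - a%:C).

Lemma cis2_sub t : cis t ^+ 2 - a%:C != 0.
Proof.
rewrite subr_eq0; apply/eqP => /(congr1 (@cmod R)).
rewrite cmodX cmod_cis expr1n cmodR gtr0_norm // => h.
by move: a1; rewrite -h ltxx.
Qed.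

Let kapE t : kap t = conjc (geomk (cis t)).
Proof.
have h := cis2_sub t; rewrite -csym_geomk ?cmod_cis // /geomk /kap cis_conj exprVn.
have c0 := cis_neq0 t.
have h2 : cis t ^+ 2 != 0 by rewrite expf_neq0.
rewrite -[X in (X - _ / _)^-1](divff h2) -mulrBl invfM invrK [RHS]mulrC.
done.
Qed.

Let ccont_kap : ccont kap.
Proof.
apply: ccontM; first by apply: ccontX; exact: ccont_cis.
apply: ccontV => [t|]; first exact: cis2_sub.
by apply: ccontD; [apply: ccontX; exact: ccont_cis|exact: ccont_cst].
Qed.

Let cX n : continuous (fun t : R => complex.Re (cis t ^+ n)).
Proof. exact: (ccontX n (@ccont_cis R)).1. Qed.

(** From z^(m+2) kap = z^(m+2) + a z^m kap the moments satisfy a recursion of step two. The starting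
    moments n = 0, 1 come from the mean value property, after conjugating the kernel into the disc
    algebra. *)
Lemma I0_pole_X n : I0 (fun t => complex.Re (cis t ^+ n * kap t)) =
  pi * ((s ^+ n + (- s) ^+ n) / 2).
Proof.
have base0 : I0 (fun t => complex.Re (cis t ^+ 0 * kap t)) = pi.
  have -> : (fun t => complex.Re (cis t ^+ 0 * kap t)) =
      fun t => complex.Re (geomk (cis t)).
    by apply/funext => t; rewrite expr0 mul1r kapE ReJ.
  by rewrite mean_value // /geomk expr0n mulr0 subr0 invr1 mulr1.
have base1 : I0 (fun t => complex.Re (cis t ^+ 1 * kap t)) = 0.
  have -> : (fun t => complex.Re (cis t ^+ 1 * kap t)) =
      fun t => complex.Re (cis t ^+ 1) + a * complex.Re (cis t * geomk (cis t)).
    apply/funext => t; rewrite kapE.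
    have e : conjc (cis t ^+ 1 * conjc (geomk (cis t))) = conjc (cis t) + a%:C * (cis t * geomk (cis t)).
rewrite conjcM conjcK expr1 cis_conj /geomk.
      have h1 : 1 - a%:C * cis t ^+ 2 != 0.
        by rewrite -cmod_gt0; apply: lt_le_trans (one_sub_azz _); rewrite ?subr_gt0 ?cmod_cis.
      have h2 := cis_neq0 t.
      by field; rewrite h1 h2.
    by rewrite -ReJ e ReD ReJ Re_scale.
  have dm : DA (fun w => w * geomk w) by apply: DA_M => //; exact: DA_id.
  have sm : csym (fun w => w * geomk w) by apply: csym_M.
  have cm : continuous (fun t => complex.Re (cis t * geomk (cis t))).
    exact: (DA_ccont dm).1.
  rewrite I0D //; last by move=> x; apply: cvgM; [exact: cvg_cst|exact: cm].
  by rewrite I0_cisX /= mulr0 add0r I0Z // (mean_value dm sm) mul0r /= !mulr0.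
have step m : I0 (fun t => complex.Re (cis t ^+ m.+2 * kap t)) =
    a * I0 (fun t => complex.Re (cis t ^+ m * kap t)).
  have ck : continuous (fun t => complex.Re (cis t ^+ m * kap t)).
    by apply: (ccontM _ _).1; [apply: ccontX; exact: ccont_cis|].
  have -> : (fun t => complex.Re (cis t ^+ m.+2 * kap t)) =
      fun t => complex.Re (cis t ^+ m.+2) + a * complex.Re (cis t ^+ m * kap t).
    apply/funext => t; have h := cis2_sub t.
    have -> : cis t ^+ m.+2 * kap t = cis t ^+ m.+2 + a%:C * (cis t ^+ m * kap t).
      by rewrite /kap -addn2 exprD; field.
    by rewrite ReD Re_scale.
  rewrite I0D //; last by move=> x; apply: cvgM; [exact: cvg_cst|exact: ck].
  by rewrite I0Z // I0_cisX /= mulr0 add0r.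
suff [] : I0 (fun t => complex.Re (cis t ^+ n * kap t)) = pi * ((s ^+ n + (- s) ^+ n) / 2) /\
   I0 (fun t => complex.Re (cis t ^+ n.+1 * kap t)) = pi * ((s ^+ n.+1 + (- s) ^+ n.+1) / 2).
  by [].
elim: n => [|n [IH1 IH2]].
  rewrite base0 base1 !expr0 !expr1 subrr mul0r mulr0; split => //.
  by field.
split=> //; rewrite step IH1 -saE -[n.+2]addn2 !exprD sqrrN; ring.
Qed.

Lemma pole_value G : DA G -> csym G ->
  I0 (fun t => complex.Re (G (cis t) * kap t)) =
  pi * (complex.Re (G s%:C + G (- s%:C)) / 2).
Proof.
move=> hG sG.
have [B B0 hB] := DA_bounded DA_geomk.
have ms : cmod s%:C <= 1 by rewrite cmodR gtr0_norm // ltW //; case/andP: s01.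
apply: (@half_circle_ext kap B pi (fun G => pi * (complex.Re (G s%:C + G (- s%:C)) / 2))) => //.
- by move=> t; rewrite kapE cmod_conj hB // cmod_cis.
- move=> G' H e h; rewrite -mulrBr normrM gtr0_norm ?pi_gt0 // ler_pM2l ?pi_gt0 //.
  have h1 := h _ ms; have h2 : cmod (G' (- s%:C) - H (- s%:C)) <= e by apply: h; rewrite cmodN.
  rewrite -mulrBl -ReN -ReD.
  have -> : G' s%:C + G' (- s%:C) - (H s%:C + H (- s%:C)) =
    (G' s%:C - H s%:C) + (G' (- s%:C) - H (- s%:C)) by ring.
  rewrite normrM normfV (ger0_norm (ler0n _ 2)) ler_pdivrMr //.
  apply: le_trans (Re_le_cmod _) _; apply: le_trans (cmodD _ _) _; lra.
- move=> n c; rewrite -big_split /= Re_sum mulr_suml mulr_sumr; apply: eq_bigr => i _.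
  rewrite I0_pole_X -mulrDr -rmorphN -!rmorphXn -rmorphD -rmorphM /=; ring.
Qed.

End Pole.
End Residues.

(** * Partial fractions with simple nodes *)

Section PartialFractions.
Variable K : fieldType.
Implicit Types (l : seq K) (x a b : K).

(** The induction hypothesis is applied twice, at x and at the new node c, whose own coefficient is
    a product over the old nodes. *)
Lemma partial_fractions l x : uniq l -> x \notin l -> (0 < size l)%N ->
  \prod_(a <- l) (x - a)^-1 =
  \sum_(a <- l) (x - a)^-1 * \prod_(b <- l | b != a) (a - b)^-1.
Proof.
elim: l x => // c l IH x /= /andP[cl ul]; rewrite inE negb_or => /andP[xc xl] _.
have [l0|l0] := eqVneq l [::].
  by rewrite l0 !big_seq1 big_cons big_nil eqxx /= mulr1.
have sl : (0 < size l)%N by rewrite lt0n size_eq0.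
have hx := IH x ul xl sl; have hc := IH c ul cl sl.
rewrite !big_cons eqxx /= hx.
have -> : \prod_(b <- l | b != c) (c - b)^-1 = \prod_(b <- l) (c - b)^-1.
  rewrite big_seq_cond [RHS]big_seq; apply: eq_bigl => b.
  by case bl : (b \in l) => //=; apply: contraNneq cl => <-.
rewrite hc !mulr_sumr -big_split /= big_seq [RHS]big_seq; apply: eq_bigr => a al.
have ac : a != c by apply: contraNneq cl => <-.
have ca : c != a by rewrite eq_sym.
have xa : x != a by apply: contraNneq xl => ->.
rewrite big_cons ca.
move: (\prod_(b <- l | b != a) _) => p.
have h1 : x - c != 0 by rewrite subr_eq0.
have h2 : x - a != 0 by rewrite subr_eq0.
have h3 : a - c != 0 by rewrite subr_eq0.
have h4 : c - a != 0 by rewrite subr_eq0.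
have -> : (c - a)^-1 = - (a - c)^-1 by rewrite -invrN opprB.
by field; rewrite h1 h2 h3.
Qed.

Lemma partial_fractions0 l x : uniq l -> 0 \notin l -> x \notin l -> x != 0 ->
  \prod_(a <- l) (x - a)^-1 =
  \prod_(a <- l) (- a)^-1 +
  \sum_(a <- l) (x / (x - a)) * (a * \prod_(b <- l | b != a) (a - b))^-1.
Proof.
move=> ul l0 xl x0.
have := @partial_fractions (0 :: l) x; rewrite /= ul l0 inE negb_or x0 xl => /(_ isT isT isT).
rewrite !big_cons eqxx /= subr0 => /(congr1 (fun y => x * y)).
rewrite mulrA divff // mul1r => ->; rewrite mulrDr mulrA divff // mul1r; congr (_ + _).
  rewrite big_seq_cond [RHS]big_seq; apply: eq_big => [b|b _]; last by rewrite sub0r.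
  by case bl : (b \in l) => //=; apply: contraNneq l0 => <-.
rewrite mulr_sumr big_seq [RHS]big_seq; apply: eq_bigr => a al.
have a0 : a != 0 by apply: contraNneq l0 => <-.
rewrite big_cons eq_sym a0 subr0 invfM prodfV; ring.
Qed.

End PartialFractions.

Section ResidueFormula.
Variable R : realType.

(** A is a function of z whereas the poles are in z^2, so each a contributes the average of A over
    both square roots. The constant term of the partial fractions is handled by [mean_value]. *)
Lemma residue_formula (l : seq R) (A : R[i] -> R[i]) : uniq l ->
  (forall a, a \in l -> 0 < a < 1) -> DA A -> csym A ->
  I0 (fun t => complex.Re (A (cis t) * \prod_(a <- l) (cis t ^+ 2 - a%:C)^-1)) =
  pi * (complex.Re (A 0) * \prod_(a <- l) (- a)^-1 +
   \sum_(a <- l) complex.Re (A (Num.sqrt a)%:C + A (- (Num.sqrt a)%:C)) / 2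
       * (a * \prod_(b <- l | b != a) (a - b))^-1).
Proof.
move=> ul l01 hA sA.
pose lam a := (a * \prod_(b <- l | b != a) (a - b))^-1.
pose kap (a t : R) := cis t ^+ 2 / (cis t ^+ 2 - a%:C).
have sq a : a \in l -> 0 < Num.sqrt a < 1.
  move=> /l01 /andP[a0 a1]; rewrite sqrtr_gt0 a0 /=.
  by rewrite -(sqrtr1 R) ltr_sqrt.
have sqE a : a \in l -> Num.sqrt a ^+ 2 = a.
  by move=> /l01 /andP[a0 a1]; rewrite sqr_sqrtr // ltW.
have e t : complex.Re (A (cis t) * \prod_(a <- l) (cis t ^+ 2 - a%:C)^-1) =
   (\prod_(a <- l) (- a)^-1) * complex.Re (A (cis t)) +
   \sum_(a <- l) lam a * complex.Re (A (cis t) * kap a t).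
  have h := @partial_fractions0 _ (map (real_complex R) l) (cis t ^+ 2).
  have hu : uniq (map (real_complex R) l) by rewrite map_inj_uniq //; exact: complexI.
  have h0 : 0 \notin map (real_complex R) l.
    by apply/mapP => -[a /l01 /andP[a0 _] [a00]]; rewrite -a00 ltxx in a0.
  have hc : cis t ^+ 2 \notin map (real_complex R) l.
    apply/mapP => -[a al ea]; have := cis2_sub (sq a al) (sqE a al) t.
    by rewrite ea subrr eqxx.
  have := h hu h0 hc (expf_neq0 _ (cis_neq0 t)); rewrite !big_map => ->.
  rewrite mulrDr ReD mulr_sumr Re_sum; congr (_ + _).
    have -> : \prod_(a <- l) (- a%:C)^-1 = (\prod_(a <- l) (- a)^-1)%:C.
      by rewrite rmorph_prod; apply: eq_bigr => a _; rewrite fmorphV rmorphN.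
    by rewrite mulrC Re_scale.
  apply: eq_bigr => a _.
  have -> : (a%:C * \prod_(b <- [seq (b%:C) | b <- l] | b != a%:C) (a%:C - b))^-1 = (lam a)%:C.
    rewrite /lam fmorphV rmorphM rmorph_prod big_map; congr ((_ * _)^-1).
    apply: eq_big => [b|b _]; first by rewrite (inj_eq (@complexI R)).
    by rewrite rmorphB.
  by rewrite mulrA mulrC Re_scale.
rewrite (funext e).
have ck a : a \in l -> ccont (fun t => A (cis t) * kap a t).
  move=> al; apply: ccontM; first exact: DA_ccont.
  apply: ccontM; first by apply: ccontX; exact: ccont_cis.
  apply: ccontV => [t|]; first exact: cis2_sub (sq a al) (sqE a al) t.
  by apply: ccontD; [apply: ccontX; exact: ccont_cis|exact: ccont_cst].
have hs (l' : seq R) : {subset l' <= l} ->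
    continuous (fun t => \sum_(a <- l') lam a * complex.Re (A (cis t) * kap a t)) /\
    I0 (fun t => \sum_(a <- l') lam a * complex.Re (A (cis t) * kap a t)) =
    \sum_(a <- l') lam a * (pi * (complex.Re (A (Num.sqrt a)%:C + A (- (Num.sqrt a)%:C)) / 2)).
  elim: l' => [|a l' IH] sl.
    have -> : (fun t => \sum_(a <- [::]) lam a * complex.Re (A (cis t) * kap a t)) = fun=> 0.
      by apply/funext => t; rewrite big_nil.
    by rewrite I0_cst mul0r big_nil; split => // x; exact: cvg_cst.
  have al : a \in l by apply: sl; rewrite mem_head.
  have [cl Il] := IH (fun b bl => sl b (mem_behead (s := a :: l') bl)).
  have -> : (fun t => \sum_(a <- a :: l') lam a * complex.Re (A (cis t) * kap a t)) =
    fun t => lam a * complex.Re (A (cis t) * kap a t) +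
      \sum_(a <- l') lam a * complex.Re (A (cis t) * kap a t).
    by apply/funext => t; rewrite big_cons.
  have c1 : continuous (fun t => lam a * complex.Re (A (cis t) * kap a t)).
    by move=> x; apply: cvgM; [exact: cvg_cst|exact: (ck a al).1].
  split; first by move=> x; apply: cvgD; [exact: c1|exact: cl].
  rewrite I0D // Il big_cons; congr (_ + _).
  rewrite I0Z; last exact: (ck a al).1.
  by rewrite (pole_value (sq a al) (sqE a al)).
have [cs Is] := hs l (fun x h => h).
have cA := (DA_ccont hA).1.
rewrite I0D //; last by move=> x; apply: cvgM; [exact: cvg_cst|exact: cA].
rewrite I0Z // mean_value // Is mulrDr mulr_sumr; congr (_ + _).
  by rewrite mulrCA [X in _ * X]mulrC.
by apply: eq_bigr => a _; rewrite /lam mulrCA [X in _ * X]mulrC.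
Qed.

End ResidueFormula.

(** * Zeros and orthogonal polynomials *)

Section Deflation.
Variable R : realType.

(** By the last clause, a zero of E at a point of l would be a double zero of f. *)
Lemma deflation (l : seq R) (M : R) (f : nat -> R) : gb (1 / 4) M f -> uniq l ->
  (forall a, a \in l -> 0 < a <= 1 /\ cev f a%:C = 0) ->
  exists E : nat -> R, [/\ gb (1 / 4) ((2 / 3) ^+ size l * M) E,
    forall w, cmod w <= 1 -> cev f w = (\prod_(a <- l) (w - a%:C)) * cev E w &
    forall a, a \in l ->
      cev (dsq f) a%:C = (\prod_(b <- l | b != a) (a%:C - b%:C)) * cev E a%:C].
Proof.
elim: l M f => [|c l IH] M f hf ul hl.
  exists f; split => //; last by move=> w _; rewrite big_nil mul1r.
  by rewrite expr0 [1 * M]mul1r.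
move: ul => /= /andP[cl ul].
have [/andP[c0 c1] fc] := hl c (mem_head _ _).
have c01 : 0 <= c <= 1 by rewrite ltW.
have hd := gb_defl hf c01.
have cm (a : R) : a \in c :: l -> cmod a%:C <= 1.
  by move=> /hl [/andP[a0 a1] _]; rewrite cmodR gtr0_norm.
have ne (a : R) : a \in l -> a%:C - c%:C != 0 :> R[i].
  move=> al; rewrite subr_eq0 (inj_eq (@complexI R)).
  by apply: contraNneq cl => <-.
have dl a : a \in l -> cev (defl c f) a%:C = 0.
  move=> al; have al' : a \in c :: l by rewrite inE al orbT.
  have := (hl a al').2; rewrite (cev_defl_root hf c01 fc (cm a al')) => /eqP.
  by rewrite mulf_eq0 (negbTE (ne a al)) => /eqP.
have hl' a : a \in l -> 0 < a <= 1 /\ cev (defl c f) a%:C = 0.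
  by move=> al; split; [exact: (hl a (mem_behead (s := c :: l) al)).1|exact: dl].
have [E [hE h1 h2]] := IH _ _ hd ul hl'.
exists E; split.
- by rewrite /= exprSr -mulrA.
- by move=> w w1; rewrite (cev_defl_root hf c01 fc w1) h1 // big_cons mulrA.
move=> a; rewrite inE => /orP[/eqP ->|al].
- have mc := cm c (mem_head _ _).
  rewrite (cev_dsq_defl_root hf c01 fc mc) subrr mul0r addr0 h1 // big_cons eqxx /=.
  congr (_ * _); rewrite big_seq [RHS]big_seq_cond; apply: eq_bigl => b.
  by case bl : (b \in l) => //=; apply/esym; apply: contraNneq cl => <-.
have al' : a \in c :: l by rewrite inE al orbT.
rewrite (cev_dsq_defl_root hf c01 fc (cm a al')) dl // add0r h2 // big_cons.
have -> /= : c != a by apply: contraNneq cl => ->.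
by rewrite mulrA.
Qed.

(* Each deflation shrinks the coefficient bound by 2/3 and cannot decrease the modulus of
   the value at 0. *)
Lemma zeros_bounded (M : R) (f : nat -> R) : gb (1 / 4) M f -> f 0%N != 0 ->
  exists K, forall l : seq R, uniq l ->
    (forall a, a \in l -> 0 < a <= 1 /\ cev f a%:C = 0) -> (size l < K)%N.
Proof.
move=> hf f0.
have h23 : 0 <= (2 / 3 : R) < 1 by lra.
have e0 : 0 < `|f 0%N| / 2 by rewrite divr_gt0 // normr_gt0.
have [K hK] := small_geo M h23 e0; exists K => l ul hl.
rewrite ltnNge; apply/negP => Kl.
have [E [hE h1 _]] := deflation hf ul hl.
have m0 : cmod (0 : R[i]) <= 1 by rewrite cmod0.
have := h1 0 m0; rewrite !cev0 => /(congr1 (@cmod R)).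
rewrite cmodM !cmodR => e.
have hp : cmod (\prod_(a <- l) (0 - a%:C)) <= 1.
  rewrite big_seq; elim/big_ind: _ => [|x y hx hy|a /hl [/andP[a0 a1] _]].
  - by rewrite cmod1.
  - by rewrite cmodM mulr_ile1 ?cmod_ge0.
  - by rewrite sub0r cmodN cmodR gtr0_norm.
have := hE 0%N; rewrite expr0 mulr1 mulrC => hE0.
have := hK _ Kl => hKl.
have : `|f 0%N| <= `|f 0%N| / 2.
  rewrite {1}e; apply: le_trans hKl; apply: le_trans hE0.
  by rewrite ler_piMl.
by have := normr_gt0 (f 0%N); rewrite f0 => ?; lra.
Qed.

(** If no finite list exhausted the zeros, every list could be extended, and lists of arbitrary
    length would contradict [zeros_bounded]. *)
Lemma all_zeros (M : R) (f : nat -> R) : gb (1 / 4) M f -> f 0%N != 0 ->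
  exists l : seq R, uniq l /\
    forall a, a \in l <-> (0 < a <= 1 /\ cev f a%:C = 0).
Proof.
move=> hf f0; have [K hK] := zeros_bounded hf f0.
apply: contrapT => hn.
have ext n : exists l : seq R, [/\ uniq l, size l = n &
    forall a, a \in l -> 0 < a <= 1 /\ cev f a%:C = 0].
  elim: n => [|n [l [ul sl hl]]]; first by exists [::].
  have [a [al ha]] : exists a, a \notin l /\ (0 < a <= 1 /\ cev f a%:C = 0).
    apply: contrapT => hna; apply: hn; exists l; split => // a; split; first exact: hl.
    by move=> ha; apply: contrapT => /negP al; apply: hna; exists a.
  exists (a :: l); split => /=; [by rewrite al|by rewrite sl|].
  by move=> b; rewrite inE => /orP[/eqP ->|/hl].
have [l [ul sl hl]] := ext K; have := hK l ul hl; by rewrite sl ltnn.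
Qed.

Lemma cev_real_cvg (M a : R) (f : nat -> R) : gb (1 / 4) M f -> 0 < a < 1 ->
  (fun y : R => complex.Re (cev f y%:C)) @ a --> complex.Re (cev f a%:C).
Proof.
move=> hf /andP[a0 a1]; apply/cvgrPdist_le => e e0; have M0 := gb_ge0 hf.
pose d : R := e / (2 * M + 1).
have d0 : 0 < d by rewrite divr_gt0 // ltr_wpDl // mulr_ge0.
near=> y.
have y0 : 0 < y by near: y; exact: lt_nbhsr.
have y1 : y < 1 by near: y; exact: lt_nbhsl.
have ay : `|a - y| < d by near: y; apply/nbhs_ballP; exists d.
rewrite -ReN -ReD; apply: le_trans (Re_le_cmod _) _.
have ma : cmod a%:C <= 1 by rewrite cmodR gtr0_norm // ltW.
have my : cmod y%:C <= 1 by rewrite cmodR gtr0_norm // ltW.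
apply: le_trans (cev_lipschitz hf ma my) _.
rewrite -rmorphB /= cmodR.
have := ler_wpM2l (mulr_ge0 (ler0n R 2) M0) (ltW ay).
move=> h; apply: le_trans h _; rewrite /d mulrCA ler_piMr ?(ltW e0) //.
by rewrite ler_pdivrMr ?mul1r ?lerDl // ltr_wpDl // mulr_ge0.
Unshelve. all: by end_near. Qed.

(** With the deflated series d one has f((s + h)^2) = h (h + 2 s) d((s + h)^2), so the difference
    quotient is explicit and only continuity of d is needed. The formula for psi is available only
    on (0, 1), hence for small h. *)
Lemma derive1_zero (M s : R) (f : nat -> R) (psi : R -> R) : gb (1 / 4) M f -> 0 < s < 1 ->
  cev f (s ^+ 2)%:C = 0 ->
  (forall x, 0 < x < 1 -> psi x = x^-1 * complex.Re (cev f (x ^+ 2)%:C)) ->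
  derive1 psi s = 2 * complex.Re (cev (dsq f) (s ^+ 2)%:C).
Proof.
move=> hf s01 fs hpsi; have := s01 => /andP[s0 s1].
set a := s ^+ 2 in fs *.
have a0 : 0 < a by rewrite exprn_gt0.
have a1 : a < 1 by rewrite exprn_ilt1 // ltW.
have a01 : 0 <= a <= 1 by rewrite !ltW.
have ma : cmod a%:C <= 1 by rewrite cmodR gtr0_norm // ltW.
rewrite (cev_dsq_defl_root hf a01 fs ma) subrr mul0r addr0.
have hd := gb_defl hf a01; set d := defl a f in hd *.
pose e (y : R) := complex.Re (cev d y%:C).
have ps : psi s = 0 by rewrite hpsi // -/a fs mulr0.
apply: cvg_lim => //.
have lim : (fun h : R => (h + s)^-1 * (h + 2 * s) * e ((h + s) ^+ 2)) @ 0^' --> 2 * e a.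
  have -> : 2 * e a = (0 + s)^-1 * (0 + 2 * s) * e ((0 + s) ^+ 2).
    by rewrite !add0r -/a; congr (_ * _); field; rewrite gt_eqF.
  apply: cvg_within_filter.
  have cs : (fun h : R => h + s) @ 0 --> 0 + s by apply: cvgD; [exact: cvg_id|exact: cvg_cst].
  apply: cvgM; first apply: cvgM.
  - by apply: cvgV => //; rewrite add0r gt_eqF.
  - by apply: cvgD; [exact: cvg_id|exact: cvg_cst].
  apply: (@cvg_comp _ _ _ (fun h : R => (h + s) ^+ 2) e _ (nbhs ((0 + s) ^+ 2))).
    rewrite (_ : (fun h : R => (h + s) ^+ 2) = (fun h : R => (h + s) * (h + s))).
      by rewrite expr2; apply: cvgM.
    by apply/funext => h; rewrite expr2.
  rewrite add0r -/a; apply: (cev_real_cvg hd); by rewrite a0.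
apply: cvg_trans lim; apply: near_eq_cvg.
rewrite near_withinE; near=> h; move=> h0.
have hs0 : 0 < h + s.
  by near: h; apply: (cvgr_gt (0 + s)); [apply: cvgD; [exact: cvg_id|exact: cvg_cst]|rewrite add0r].
have hs1 : h + s < 1.
  by near: h; apply: (cvgr_lt (0 + s)); [apply: cvgD; [exact: cvg_id|exact: cvg_cst]|rewrite add0r].
rewrite /= ps subr0 hpsi ?hs0 //.
have hm : cmod ((h + s) ^+ 2)%:C <= 1.
  by rewrite cmodR ger0_norm ?sqr_ge0 // exprn_ile1 // ltW.
rewrite (cev_defl_root hf a01 fs hm) -rmorphB Re_scale -/(e _) /GRing.scale /=.
have -> : (h + s) ^+ 2 - a = h * (h + 2 * s) by rewrite /a; ring.
have hn : h != 0 by [].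
by rewrite [X in _ = X](_ : _ = (h^-1 * h) * ((h + s)^-1 * (h + 2 * s) * e ((h + s) ^+ 2)));
  [rewrite mulVf // mul1r|ring].
Unshelve. all: by end_near. Qed.

End Deflation.

(** * Orthogonality from the three-term recurrence *)

Section Favard.
Variables (R : comNzRingType) (p : nat -> {poly R}) (g : nat -> R).
Hypotheses (p0 : p 0%N = 1) (p1 : p 1%N = 'X).
Hypothesis pS : forall n, p n.+2 = 'X * p n.+1 - (g n * g n.+1)%:P * p n.

(** Induction on two consecutive rows m, m + 1: the recurrence lowers the first index, and the
    factor X is moved to [p n], where the recurrence applies again. *)
Lemma favard_orthogonality (L : {poly R} -> R) :
  (forall x y, L (x + y) = L x + L y) -> (forall c x, L (c%:P * x) = c * L x) ->
  (forall n, L (p n) = g 0%N * (n == 0%N)%:R) ->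
  forall m n, L (p m * p n) =
    (\prod_(j < n) g j) * (\prod_(j < n.+1) g j) * (m == n)%:R.
Proof.
move=> LD LZ L1; pose h n := (\prod_(j < n) g j) * (\prod_(j < n.+1) g j).
have L0 : L 0 = 0 by have := LZ 0 0; rewrite mulr0 mul0r.
have LB x y : L (x - y) = L x - L y.
  by rewrite LD; congr (_ + _); have := LZ (-1) y; rewrite polyCN polyC1 !mulN1r.
have hS n : h n.+1 = g n * g n.+1 * h n.
  by rewrite /h !big_ord_recr /=; ring.
have Xp0 : 'X * p 0%N = p 1%N by rewrite p0 p1 mulr1.
have XpS n : 'X * p n.+1 = p n.+2 + (g n * g n.+1)%:P * p n by rewrite pS subrK.
have H0 n : L (p 0%N * p n) = h n * (0%N == n)%:R.
  rewrite p0 mul1r L1; case: n => [|n]; last by rewrite !mulr0.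
  by rewrite /h big_ord0 big_ord1 mul1r.
have step m : (forall n, L (p m.+1 * p n) = h n * (m.+1 == n)%:R) ->
    (forall n, L (p m * p n) = h n * (m == n)%:R) ->
    forall n, L (p m.+2 * p n) = h n * (m.+2 == n)%:R.
  move=> H2 H1 n.
  have -> : p m.+2 * p n = p m.+1 * ('X * p n) - (g m * g m.+1)%:P * (p m * p n).
    by rewrite pS; ring.
  rewrite LB LZ H1; case: n => [|n].
    rewrite Xp0 H2 eqSS mulr0; case: m {H1 H2} => [|m]; last by rewrite !mulr0 subrr.
    by rewrite !mulr1 hS subrr.
  rewrite XpS mulrDr LD mulrCA LZ !H2 !eqSS.
  have -> : h n.+2 * (m == n.+1)%:R = g m * g m.+1 * (h n.+1 * (m == n.+1)%:R).
    by have [->|_] := eqVneq m n.+1; rewrite ?mulr0 // hS !mulr1.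
  by rewrite addrAC subrr add0r hS mulrA.
have H1 n : L (p 1%N * p n) = h n * (1%N == n)%:R.
  rewrite p1; case: n => [|n].
    by have := H0 1%N; rewrite Xp0 p0 mul1r => ->; rewrite !mulr0.
  rewrite XpS LD LZ; have := H0 n.+2; have := H0 n; rewrite p0 !mul1r => -> ->.
  by rewrite mulr0 add0r hS eqSS mulrA.
move=> m n; suff [] : (forall n, L (p m * p n) = h n * (m == n)%:R) /\
  (forall n, L (p m.+1 * p n) = h n * (m.+1 == n)%:R) by move=> ->.
elim: m => [|m [IH1 IH2]]; first by split.
by split => // k; exact: step.
Qed.

End Favard.

Section PolynomialSolutions.
Variables (R : realType) (q alpha beta : R).
Local Notation p := (pAB alpha beta q).
Local Notation g := (gtil alpha beta q).

Lemma pAB0 : p 0 = 1. Proof. by []. Qed.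
Lemma pAB1 : p 1 = 'X. Proof. by []. Qed.

Lemma pABS n : p n.+2 = 'X * p n.+1 - (g n * g n.+1)%:P * p n.
Proof. by rewrite /pAB /=; case: (pq alpha beta q n). Qed.

(** Rescaling by the product of the g's makes the recurrence monic. The condition on [s 1] encodes a
    vanishing value at index -1, matching p_(-1) = 0, and so fixes s up to a factor. *)
Lemma pAB_solution (v : R) (s : nat -> R) : (forall n, g n != 0) ->
  s 1%N = v * (g 0%N)^-1 * s 0%N ->
  (forall n, s n.+2 = v * (g n.+1)^-1 * s n.+1 - s n) ->
  forall n, (p n).[v] * s 0%N = (\prod_(j < n) g j) * s n.
Proof.
move=> g0 s1 sS n.
suff [] : (p n).[v] * s 0%N = (\prod_(j < n) g j) * s n /\
   (p n.+1).[v] * s 0%N = (\prod_(j < n.+1) g j) * s n.+1 by [].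
elim: n => [|n [IH1 IH2]].
  rewrite pAB0 pAB1 big_ord0 big_ord_recr big_ord0 hornerX hornerC mul1r s1 /=; split => //.
  by field.
split=> //; rewrite pABS hornerD hornerN !hornerM hornerX hornerC mulrBl -mulrA IH2 -mulrA IH1 sS.
by rewrite !big_ord_recr /=; field; exact: g0.
Qed.

End PolynomialSolutions.

(** * The spectral functional *)

(** Here t1 = T_1(a), tn = T_(n+1)(a), d = T_0'(a), sn and sn' are n-th powers of the two square
    roots of a, and pp, pm the values of p_n at the two mass points: the residues of the integral
    cancel the masses. *)
Lemma residue_mass_cancel (R : realType) (G a d t1 tn sn sn' pp pm : R) : a != 0 -> d != 0 ->
  pp * t1 = G * (sn * tn) -> pm * t1 = G * (sn' * tn) ->
  G / 2 * (sn * tn * (1 - a) / (a * d) + sn' * tn * (1 - a) / (a * d)) +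
  (a - 1) / a * (t1 / (2 * d)) * (pp + pm) = 0.
Proof.
move=> a0 d0 h1 h2.
have -> : (a - 1) / a * (t1 / (2 * d)) * (pp + pm) =
  (a - 1) / (2 * a * d) * (pp * t1 + pm * t1) by field; rewrite a0 d0.
by rewrite h1 h2; field; rewrite a0 d0.
Qed.

Section SplitAtOne.
Variables (R : realType) (K : comNzRingType).

(** A zero of T_0 at 1 lies on the circle and is not a pole to be integrated, so its factor is set
    apart. *)
Lemma prod_split1 (l : seq R) (F : R -> K) : uniq l -> (forall a, a \in l -> a <= 1) ->
  \prod_(a <- l) F a = (if 1 \in l then F 1 else 1) * \prod_(a <- l | a < 1) F a.
Proof.
move=> ul l1; rewrite (bigID (fun a => a < 1)) /= mulrC; congr (_ * _).
have e a : (a \in l) && ~~ (a < 1) = (a \in l) && (a == 1).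
  case al : (a \in l) => //=; rewrite -leNgt eq_le; by rewrite (l1 a al).
rewrite big_seq_cond (eq_bigl _ _ e) -big_seq_cond.
case: ifP => h1; first by rewrite -big_filter (filter_pred1_uniq ul h1) big_seq1.
rewrite big_seq_cond big_pred0 // => a; case: eqP => [->|]; rewrite ?andbF //.
by rewrite h1.
Qed.

Lemma prod_split1_cond (l : seq R) (F : R -> K) (a : R) :
  uniq l -> (forall a, a \in l -> a <= 1) -> a < 1 ->
  \prod_(b <- l | b != a) F b =
  (if 1 \in l then F 1 else 1) * \prod_(b <- [seq b <- l | b < 1] | b != a) F b.
Proof.
move=> ul l1 a1; rewrite big_mkcond prod_split1 //.
have -> : (1 != a) = true by rewrite eq_sym lt_eqF.
by rewrite -big_filter [in RHS]big_mkcond.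
Qed.

End SplitAtOne.

Section SpectralMeasure.
Variables (R : realType) (q alpha beta : R).
Hypothesis q01 : 0 < q < 1.
Hypothesis al1 : -1 < alpha < 1.
Hypothesis be1 : beta < 1.

Local Notation Tn := (jost q alpha beta).
Local Notation dTn := (djost q alpha beta).
Local Notation Xn := (xinf q).
Local Notation g := (gtil alpha beta q).
Local Notation p := (pAB alpha beta q).

(* T_0 = prod (w - a) * E with E without zeros in the disc; Q is (1 - w) / E, or - 1 / E when
   T_0 vanishes at w = 1. *)
Lemma jost_factorization : exists (l : seq R) (Q : R[i] -> R[i]),
  [/\ uniq l, (forall a, a \in l <-> (0 < a < 1 /\ Tn 0 a%:C = 0)), DA Q /\ csym Q,
   (forall w, cmod w <= 1 -> w != 1 -> (forall a, a \in l -> w != a%:C) ->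
      (1 - w) / Tn 0 w = Q w * \prod_(a <- l) (w - a%:C)^-1) &
   (forall a, a \in l -> Q a%:C * (\prod_(b <- l | b != a) (a%:C - b%:C))^-1
      = (1 - a%:C) / dTn 0 a%:C)].
Proof.
have [M hM] := tc_bound q01 beta al1; have hM0 := hM 0%N.
have c0 : tc q alpha beta 0 0%N != 0.
  have := @jost0_neq0 _ _ _ _ q01 al1 be1 0; rewrite cmod0 ler01 /jost cev0 => /(_ isT) h.
  rewrite -(inj_eq (@complexI R)); apply: h => a /andP[a0 _].
  by rewrite eq_sym (inj_eq (@complexI R)) gt_eqF.
have [l [ul hl]] := all_zeros hM0 c0.
have [E [hE h1 h2]] := deflation hM0 ul (fun a h => (hl a).1 h).
have l1 a : a \in l -> a <= 1 by move=> /hl [/andP[]].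
have ml a : a \in l -> cmod a%:C <= 1.
  by move=> /hl [/andP[a0 a1] _]; rewrite cmodR gtr0_norm.
(* A zero of E in the disc would be a zero of T_0, hence a member of l, and then a double one,
   against [jost0_simple]. *)
have E0 w : cmod w <= 1 -> cev E w != 0.
  move=> w1; apply/eqP => Ew0.
  have Tw0 : Tn 0 w = 0 by rewrite /jost h1 // Ew0 mulr0.
  have [a [a01 wa]] : exists a : R, 0 < a <= 1 /\ w = a%:C.
    apply: contrapT => hn; have /eqP := Tw0; apply/negP.
    apply: (jost0_neq0 q01 al1 be1 w1) => a a01; apply/eqP => wa; apply: hn.
    by exists a.
  have al : a \in l by apply/hl; rewrite -wa.
  have := jost0_simple q01 al1 be1 a01; rewrite -wa => /(_ Tw0) /eqP; apply.
  by rewrite /djost wa h2 // -wa Ew0 mulr0.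
have [d d0 hd] := cev_lower hE E0.
pose Bo (o : bool) (w : R[i]) := if o then -1 else 1 - w.
have dBo o : DA (Bo o).
  case: o; first by apply: eq_DA (DA_horner (-1)%:P) => w _; rewrite hornerC.
  by apply: eq_DA (DA_horner (1 - 'X)) => w _; rewrite hornerD hornerN hornerC hornerX.
have sBo o : csym (Bo o).
  case: o => w _; rewrite /Bo; first by rewrite rmorphN rmorph1.
  by rewrite rmorphB rmorph1.
have BoE o w : Bo o w * (if o then w - 1 else 1) = 1 - w.
  by rewrite /Bo; case: o; rewrite ?mulr1 // mulN1r opprB.
pose o := 1 \in l; pose B := Bo o.
have dB : DA B := dBo o; have sB : csym B := sBo o; have BE w : B w * (if o then w - 1 else 1) = 1 - w := BoE o w.
pose l' := [seq a <- l | a < 1].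
have dE : DA (fun w => (cev E w)^-1).
  by apply: DA_inv d0 hd; apply: DA_cev; exact: gb_quarter_geo hE.
have sE : csym (fun w => (cev E w)^-1).
  apply: csym_V => w w1; apply: cev_conj => //; exact: gb_quarter_geo hE.
exists l', (fun w => B w * (cev E w)^-1); split.
- exact: filter_uniq.
- move=> a; rewrite mem_filter; split.
    by move=> /andP[a1 /hl [/andP[a0 _] Ta]]; rewrite a0 a1.
  by move=> [/andP[a0 a1] Ta]; rewrite a1 /=; apply/hl; rewrite a0 ltW.
- by split; [exact: DA_M|exact: csym_M].
- move=> w w1 wn1 wl; rewrite /jost h1 // (prod_split1 _ ul l1) -/o -(BE w) /l' big_filter.
  have p0 : \prod_(a <- l | a < 1) (w - a%:C) != 0.
    rewrite prodf_seq_neq0; apply/allP => a al; apply/implyP => a1.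
    by rewrite subr_eq0 wl // mem_filter a1.
  have o0 : (if o then w - 1 else 1) != 0 by case: ifP; rewrite ?oner_neq0 // subr_eq0.
  rewrite prodfV -[w - 1%:C]/(w - 1).
  move: (E0 w w1) p0 o0; set e := cev E w; set P := \prod_(_ <- _ | _) _.
  set O := (if o then w - 1 else 1) => e0 P0 O0.
  by field; rewrite e0 P0 O0.
- move=> a; rewrite mem_filter => /andP[a1 al].
  rewrite /djost h2 // (prod_split1_cond _ ul l1 a1) -/o -/l' -(BE a%:C).
  have p0 : \prod_(b <- l' | b != a) (a%:C - b%:C) != 0.
    rewrite prodf_seq_neq0; apply/allP => b _; apply/implyP => ba.
    by rewrite subr_eq0 (inj_eq (@complexI R)) eq_sym.
  have o0 : (if o then a%:C - 1 else 1) != 0 :> R[i].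
    case: ifP; rewrite ?oner_neq0 // subr_eq0 -(rmorph1 (real_complex R)).
    by rewrite (inj_eq (@complexI R)) lt_eqF.
  rewrite -[a%:C - 1%:C]/(a%:C - 1).
  move: (E0 _ (ml a al)) p0 o0; set e := cev E _; set P := \prod_(_ <- _ | _) _.
  set O := (if o then _ else 1) => e0 P0 O0.
  by field; rewrite e0 P0 O0.
Qed.

Lemma jost_three_term N (z : R[i]) : z != 0 -> cmod z <= 1 ->
  z ^+ N.+2 * Tn N.+2 (z ^+ 2) =
  (z + z^-1) * (((g N)^-1)%:C * (z ^+ N.+1 * Tn N.+1 (z ^+ 2))) - z ^+ N * Tn N (z ^+ 2).
Proof.
move=> z0 z1; have := jost_rec beta q01 al1 N (cmodX2 z1).
set t0 := Tn N _; set t1 := Tn N.+1 _; set t2 := Tn N.+2 _; set d := _%:C => e.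
have -> : z ^+ N.+2 * t2 = z ^+ N * (t0 + z ^+ 2 * t2) - z ^+ N * t0.
  by rewrite -addn2 exprD; ring.
by clearbody t0 t1 t2 d; rewrite e (exprS z N); field.
Qed.

Lemma g_neq0 n : g n != 0.
Proof. by rewrite gt_eqF // gtil_gt0. Qed.

(** On the unit circle 1 - z^2 = - 2 i (Im z) z. *)
Lemma Re_wronskian (z u c : R[i]) : csqabs z = 1 ->
  complex.Re (u * (1 - z ^+ 2) / c) = 2 * complex.Im z * complex.Im (z * u * conjc c) / csqabs c.
Proof.
move=> z1; rewrite invcE mulrCA Re_scale mulrC; congr (_ / _).
have -> : u * (1 - z ^+ 2) * conjc c = (u * conjc c) * (1 - z * z) by ring.
have -> : z * u * conjc c = z * (u * conjc c) by ring.
move: (u * conjc c) => [A B]; move: z1; case: z => x y; rewrite /csqabs /=.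
move=> z1; apply/eqP; rewrite -subr_eq0; apply/eqP.
by transitivity (A * (1 - (x ^+ 2 + y ^+ 2))); [ring|rewrite z1 subrr mulr0].
Qed.

Lemma weight_arith (x C S G P u : R) : x != 0 -> C != 0 -> P * (u * x) = G * S ->
  P * u ^+ 2 / (C / x) = G * (2 * u * S / C / 2).
Proof.
move=> x0 C0 h.
have -> : P * u ^+ 2 / (C / x) = (P * (u * x)) * u / C by field; rewrite x0 C0.
by rewrite h; field.
Qed.

Lemma weight_identity n t : 0 < t < pi ->
  (p n).[2 * cos t] * sin t ^+ 2 / csqabs (phi21 alpha beta q t) =
  (\prod_(j < n) g j) *
  (complex.Re (cis t ^+ n * Tn n.+1 (cis t ^+ 2) * (1 - cis t ^+ 2) / Tn 0 (cis t ^+ 2)) / 2).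
Proof.
move=> t0; have st := sin_gt0_pi t0.
set z := cis t; have z1 : cmod z = 1 by rewrite cmod_cis.
have z1' : cmod z <= 1 by rewrite z1.
have z0 : z != 0 := cis_neq0 t.
have w1 := cmodX2 z1'.
have T0 : Tn 0 (z ^+ 2) != 0 by apply: jost0_neq0_Im_pos.
rewrite phi21E //; set c := Tn 0 (z ^+ 2) in T0 *; rewrite csqabsM csqabsV.
(* The imaginary part turns z^(k+1) T_(k+1) into a real solution of the recurrence; its value at
   index -1 is Im (c conj c) = 0, so it is a multiple of p_k, and [circle_wronskian] gives the
   multiple. *)
pose s k := complex.Im (z ^+ k.+1 * Tn k.+1 (z ^+ 2) * conjc c).
have vz : z + z^-1 = (2 * cos t)%:C.
  rewrite -cis_conj /z /cis; apply: complex_ext => /=; last by rewrite subrr.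
  by ring.
have sc d x y : complex.Im (((2 * cos t)%:C * (d%:C * x) - y) * conjc c) =
    2 * cos t * d * complex.Im (x * conjc c) - complex.Im (y * conjc c).
  by rewrite mulrBl ImD ImN -!mulrA !Im_scale -!mulrA.
have s0 : s 0%N = sin t * csqabs (Xn (z ^+ 2)).
  by rewrite /s expr1 (circle_wronskian beta q01 al1 z1).
have s1 : s 1%N = 2 * cos t * (g 0%N)^-1 * s 0%N.
  rewrite /s jost_three_term // vz sc expr0 mul1r -/c.
  have -> : complex.Im (c * conjc c) = 0 by case: (c) => a b /=; ring.
  by rewrite subr0.
have sS k : s k.+2 = 2 * cos t * (g k.+1)^-1 * s k.+1 - s k.
  by rewrite {1}/s jost_three_term // vz sc.
have := pAB_solution g_neq0 s1 sS n; rewrite s0.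
have z2 : csqabs z = 1 by rewrite -cmod_sq z1 expr1n.
rewrite Re_wronskian // mulrA -exprS -/(s n) -[complex.Im z]/(sin t).
have c0 : csqabs c != 0 by rewrite csqabs0.
have X0 : csqabs (Xn (z ^+ 2)) != 0 by rewrite csqabs0; exact: xinf_neq0.
exact: weight_arith.
Qed.

(** Where T_0 vanishes, z^n T_(n+1) itself satisfies the initial condition of p_n. The root z may
    have either sign, which covers both mass points. *)
Lemma pAB_at_zero n (z a : R) : z != 0 -> z ^+ 2 = a -> 0 < a <= 1 -> Tn 0 a%:C = 0 ->
  (p n).[z + z^-1] * complex.Re (Tn 1 a%:C) =
  (\prod_(j < n) g j) * (z ^+ n * complex.Re (Tn n.+1 a%:C)).
Proof.
move=> z0 za /andP[a0 a1] Ta.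
have w1 : cmod a%:C <= 1 by rewrite cmodR gtr0_norm.
pose t N := complex.Re (Tn N a%:C).
have tE N : Tn N a%:C = (t N)%:C by rewrite /t /jost -cev_real.
have r1 N : t N + a * t N.+2 = (g N)^-1 * ((1 + a) * t N.+1).
  apply: complexI; have := jost_rec beta q01 al1 N w1.
  by rewrite !tE !rmorphD !rmorphM !rmorphD rmorph1.
have t0 : t 0%N = 0 by rewrite /t Ta.
rewrite -/(t 1%N) -/(t n.+1); clearbody t.
pose s k := z ^+ k * t k.+1.
have := @pAB_solution R q alpha beta (z + z^-1) s g_neq0.
rewrite /s expr0 mul1r; apply.
- have := r1 0%N; rewrite t0 add0r -za => e.
  have -> : z ^+ 1 * t 2%N = z^-1 * (z ^+ 2 * t 2%N) by field.
  by rewrite e; field; rewrite g_neq0 z0.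
- move=> k; have -> : z ^+ k.+2 * t k.+3 = z ^+ k * (t k.+1 + a * t k.+3) - z ^+ k * t k.+1.
    by rewrite -za -addn2 exprD; ring.
  by rewrite r1 -za (exprS z k); field; rewrite g_neq0 z0.
Qed.

Section SpectralFunctional.
Variables (l : seq R) (Q : R[i] -> R[i]).
Hypothesis ul : uniq l.
Hypothesis hl : forall a, a \in l <-> (0 < a < 1 /\ Tn 0 a%:C = 0).
Hypotheses (dQ : DA Q) (sQ : csym Q).
Hypothesis hQ1 : forall w, cmod w <= 1 -> w != 1 -> (forall a, a \in l -> w != a%:C) ->
  (1 - w) / Tn 0 w = Q w * \prod_(a <- l) (w - a%:C)^-1.
Hypothesis hQ2 : forall a, a \in l ->
  Q a%:C * (\prod_(b <- l | b != a) (a%:C - b%:C))^-1 = (1 - a%:C) / dTn 0 a%:C.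

Definition Afun n z := z ^+ n * Tn n.+1 (z ^+ 2) * Q (z ^+ 2).

(** On 0 < t < pi this is z^n (1 - w) T_(n+1) / T_0, see [KfunE]; written through Q it stays
    continuous at the endpoints. *)
Definition Kfun n t := Afun n (cis t) * \prod_(a <- l) (cis t ^+ 2 - a%:C)^-1.

(** The mass of the theorem in terms of a = z^2: psi_0(z) = T_1(a), and psi_(-1)'(z) = 2 T_0'(a) at
    a zero. *)
Definition mass a := (a - 1) / a * (complex.Re (Tn 1 a%:C) / (2 * complex.Re (dTn 0 a%:C))).

Definition vpt (a : R) : R := Num.sqrt a + (Num.sqrt a)^-1.

(** The weight is represented by the continuous function Re (Kfun 0) / 2, so linearity raises no
    question of integrability. *)
Definition Lfun (P : {poly R}) : R :=
  2 / pi * I0 (fun t => P.[2 * cos t] * (complex.Re (Kfun 0 t) / 2))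
  + \sum_(a <- l) mass a * (P.[vpt a] + P.[- vpt a]).

Let l01 a : a \in l -> 0 < a < 1.
Proof. by move=> /hl []. Qed.

Lemma DA_Afun n : DA (Afun n).
Proof.
apply: DA_M; last exact: DA_sq.
apply: DA_M; first exact: DA_X.
by apply: DA_sq; apply: DA_cev; exact: geo_tc.
Qed.

Lemma csym_Afun n : csym (Afun n).
Proof.
have s2 (F : R[i] -> R[i]) : csym F -> csym (fun w => F (w ^+ 2)).
  move=> sF w w1; have -> : (conjc w) ^+ 2 = conjc (w ^+ 2) by rewrite rmorphXn.
  by apply: sF; exact: cmodX2.
apply: csym_M; last exact: s2.
apply: csym_M; first exact: csym_X.
by apply: (s2 (Tn n.+1)) => w w1; apply: cev_conj => //; exact: geo_tc.
Qed.

Lemma cis2_notin t a : a \in l -> cis t ^+ 2 != a%:C.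
Proof.
move=> /l01 /andP[a0 a1]; apply/eqP => /(congr1 (@cmod R)).
by rewrite cmodX cmod_cis expr1n cmodR gtr0_norm // => e; rewrite -e ltxx in a1.
Qed.

Lemma ccont_Kfun n : ccont (Kfun n).
Proof.
apply: ccontM; first exact: DA_ccont (DA_Afun n).
have : {subset l <= l} by [].
elim: {-2}l => [|a l' IH] sl.
  by under eq_fun do rewrite big_nil; exact: ccont_cst.
under eq_fun do rewrite big_cons.
apply: ccontM; last by apply: IH => b bl; apply: sl; rewrite inE bl orbT.
apply: ccontV => [t|]; first by rewrite subr_eq0 cis2_notin // sl // mem_head.
by apply: ccontD; [apply: ccontX; exact: ccont_cis|exact: ccont_cst].
Qed.

Lemma KfunE n t : 0 < t < pi ->
  Kfun n t = cis t ^+ n * Tn n.+1 (cis t ^+ 2) * (1 - cis t ^+ 2) / Tn 0 (cis t ^+ 2).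
Proof.
move=> t0; rewrite /Kfun /Afun -mulrA -hQ1 ?mulrA //.
- by rewrite cmodX cmod_cis expr1n.
- have st := sin_gt0_pi t0.
  rewrite -subr_eq0 subr_sqr_1 mulf_eq0 negb_or; apply/andP; split.
    by apply: contraTneq st => /(congr1 (@complex.Im R)) /=; rewrite subr0 => ->; rewrite ltxx.
  by apply: contraTneq st => /(congr1 (@complex.Im R)) /=; rewrite addr0 => ->; rewrite ltxx.
- by move=> a; exact: cis2_notin.
Qed.

Lemma weight_Kfun n t : 0 < t < pi ->
  (p n).[2 * cos t] * sin t ^+ 2 / csqabs (phi21 alpha beta q t) =
  (\prod_(j < n) g j) * (complex.Re (Kfun n t) / 2).
Proof. by move=> t0; rewrite weight_identity // KfunE. Qed.

Lemma weight0 t : 0 < t < pi ->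
  sin t ^+ 2 / csqabs (phi21 alpha beta q t) = complex.Re (Kfun 0 t) / 2.
Proof.
by move=> t0; have := weight_Kfun 0 t0; rewrite big_ord0 pAB0 hornerC !mul1r.
Qed.

Lemma horner_cos_continuous (P : {poly R}) : continuous (fun t : R => P.[2 * cos t]).
Proof.
elim/poly_ind: P => [|P c IH].
  by under eq_fun do rewrite horner0; move=> x; exact: cvg_cst.
under eq_fun do rewrite hornerMXaddC; move=> x.
apply: cvgD; last exact: cvg_cst; apply: cvgM; first exact: IH.
by apply: cvgM; [exact: cvg_cst|exact: continuous_cos].
Qed.

Lemma Lfun_integrand_continuous (P : {poly R}) :
  continuous (fun t : R => P.[2 * cos t] * (complex.Re (Kfun 0 t) / 2)).
Proof.
move=> x; apply: cvgM; first exact: horner_cos_continuous.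
by apply: cvgM; [exact: (ccont_Kfun 0).1|exact: cvg_cst].
Qed.

Lemma LfunD (P S : {poly R}) : Lfun (P + S) = Lfun P + Lfun S.
Proof.
rewrite /Lfun addrACA -mulrDr -I0D; try exact: Lfun_integrand_continuous.
congr (_ * I0 _ + _); first by apply/funext => t; rewrite hornerD mulrDl.
by rewrite -big_split /=; apply: eq_bigr => a _; rewrite !hornerD -mulrDr; congr (_ * _); ring.
Qed.

Lemma LfunZ c (P : {poly R}) : Lfun (c%:P * P) = c * Lfun P.
Proof.
rewrite /Lfun mulrDr [c * (_ * I0 _)]mulrCA -(I0Z c); last exact: Lfun_integrand_continuous.
congr (_ * I0 _ + _); first by apply/funext => t; rewrite hornerM hornerC -mulrA.
rewrite mulr_sumr; apply: eq_bigr => a _; rewrite !hornerM !hornerC.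
by move: (mass a) (P.[vpt a]) (P.[- vpt a]) => m x y; ring.
Qed.

Lemma jost_real N (x : R) : Tn N x%:C = (complex.Re (Tn N x%:C))%:C.
Proof. exact: cev_real. Qed.

Lemma djost_real N (x : R) : dTn N x%:C = (complex.Re (dTn N x%:C))%:C.
Proof. exact: cev_real. Qed.

Lemma residue_at_zero n z a : a \in l -> z ^+ 2 = a ->
  complex.Re (Afun n z%:C) * (a * \prod_(b <- l | b != a) (a - b))^-1 =
  z ^+ n * complex.Re (Tn n.+1 a%:C) * (1 - a) / (a * complex.Re (dTn 0 a%:C)).
Proof.
move=> al za; set D := \prod_(b <- l | b != a) (a - b).
have eA : Afun n z%:C = (z ^+ n * complex.Re (Tn n.+1 a%:C))%:C * Q a%:C.
  by rewrite /Afun -!rmorphXn /= za rmorphM /= -jost_real.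
have eD : \prod_(b <- l | b != a) (a%:C - b%:C) = D%:C.
  by rewrite rmorph_prod; apply: eq_bigr => b _; rewrite rmorphB.
pose d := complex.Re (dTn 0 a%:C).
have eR : (1 - a%:C) / dTn 0 a%:C = ((1 - a) / d)%:C.
  by rewrite djost_real -/d rmorphM rmorphB rmorph1 fmorphV.
have eDV : (D%:C)^-1 = (D^-1)%:C by rewrite fmorphV.
have h : D^-1 * complex.Re (Q a%:C) = (1 - a) / d.
  by rewrite -Re_scale -eDV -eD mulrC hQ2 // eR.
rewrite eA Re_scale -/d; move: h; clearbody d.
move: (complex.Re (Q _)) (complex.Re (Tn _ _)) => r X h.
have -> : z ^+ n * X * r * (a * D)^-1 = z ^+ n * X * a^-1 * (D^-1 * r) by rewrite invfM; ring.
by rewrite h invfM; ring.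
Qed.

(** For n > 0 the factor z^n kills the contribution of the origin; for n = 0 it is T_1(0) / T_0(0),
    which the recurrence at w = 0 evaluates to g 0. *)
Lemma Afun0 n : complex.Re (Afun n 0) * \prod_(a <- l) (- a)^-1 = g 0%N * (n == 0%N)%:R.
Proof.
case: n => [|n]; last by rewrite /Afun expr0n /= !mul0r mulr0.
have m0 : cmod (0 : R[i]) <= 1 by rewrite cmod0.
have l0 a : a \in l -> (0 : R[i]) != a%:C.
  by move=> /l01 /andP[a0 _]; rewrite eq_sym (inj_eq (@complexI R)) gt_eqF.
have T00 : Tn 0 0 != 0.
  apply: (jost0_neq0 q01 al1 be1 m0) => a /andP[a0 _].
  by rewrite eq_sym (inj_eq (@complexI R)) gt_eqF.
have := hQ1 m0; rewrite eq_sym oner_neq0 => /(_ isT l0); rewrite subr0 mul1r => h.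
have eP : \prod_(a <- l) (0 - a%:C)^-1 = (\prod_(a <- l) (- a)^-1)%:C.
  by rewrite rmorph_prod; apply: eq_bigr => a _; rewrite sub0r -rmorphN fmorphV.
rewrite eP in h; rewrite mulrC -Re_scale /Afun expr0 mul1r expr0n /= mulrCA [_%:C * _]mulrC -h.
have := jost_rec beta q01 al1 0 m0; rewrite mul0r !addr0 mul1r => e.
rewrite mulr1.
have -> : Tn 1 0 = (g 0%N)%:C * Tn 0 0.
  by rewrite e mulrA -rmorphM /= divff ?g_neq0 // mul1r.
by rewrite mulfK.
Qed.

Lemma Lfun_pAB n : Lfun (p n) = g 0%N * (n == 0%N)%:R.
Proof.
set G := \prod_(j < n) g j.
have sq a : a \in l -> [/\ Num.sqrt a != 0, Num.sqrt a ^+ 2 = a & 0 < a <= 1].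
  move=> /l01 /andP[a0 a1]; split; last by rewrite a0 ltW.
    by rewrite gt_eqF // sqrtr_gt0.
  by rewrite sqr_sqrtr // ltW.
have cK : continuous (fun t => G * (complex.Re (Kfun n t) / 2)).
  move=> x; apply: cvgM; first exact: cvg_cst.
  by apply: cvgM; [exact: (ccont_Kfun n).1|exact: cvg_cst].
(* The weight identity is used for n and for 0: multiplying the weight by p_n amounts to replacing
   [Kfun 0] by a multiple of [Kfun n]. *)
have eI : I0 (fun t => (p n).[2 * cos t] * (complex.Re (Kfun 0 t) / 2)) =
    I0 (fun t => G * (complex.Re (Kfun n t) / 2)).
  apply: (I0_eq_oo cK) => t t0.
  by rewrite -(weight0 t0) mulrA (weight_Kfun n t0).
rewrite /Lfun eI.
have -> : I0 (fun t => G * (complex.Re (Kfun n t) / 2)) =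
    G / 2 * I0 (fun t => complex.Re (Kfun n t)).
  by rewrite -I0Z; [congr I0; apply/funext => t; ring|exact: (ccont_Kfun n).1].
have eR : I0 (fun t => complex.Re (Kfun n t)) = _ :=
  residue_formula ul l01 (DA_Afun n) (csym_Afun n).
rewrite eR Afun0; clear eI eR cK.
have ar (c x y : R) : 0 < c -> 2 / c * (G / 2 * (c * (x + y))) = G * x + G * y.
  by move=> c0; field; rewrite gt_eqF.
rewrite (ar _ _ _ (pi_gt0 R)).
have -> : G * (g 0%N * (n == 0%N)%:R) = g 0%N * (n == 0%N)%:R.
  by rewrite /G; case: (n) => [|k]; rewrite ?mulr0 // big_ord0 mul1r.
rewrite -addrA -[RHS]addr0; congr (_ + _).
rewrite mulr_sumr -big_split big_seq; apply: big1 => a al /=.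
have [s0 s2 a01] := sq a al; have /andP[a0 a1] := l01 al.
have Ta := ((hl a).1 al).2.
have ra := residue_at_zero n al s2.
have rb : complex.Re (Afun n (- (Num.sqrt a)%:C)) * (a * \prod_(b <- l | b != a) (a - b))^-1 =
  (- Num.sqrt a) ^+ n * complex.Re (Tn n.+1 a%:C) * (1 - a) / (a * complex.Re (dTn 0 a%:C)).
  by rewrite -rmorphN residue_at_zero // sqrrN.
have za := pAB_at_zero n s0 s2 a01 Ta.
have zb : (p n).[- vpt a] * complex.Re (Tn 1 a%:C) = G * ((- Num.sqrt a) ^+ n * complex.Re (Tn n.+1 a%:C)).
  rewrite -(pAB_at_zero n (z := - Num.sqrt a) (a := a)) ?oppr_eq0 ?sqrrN //.
  by rewrite /vpt opprD invrN.
rewrite -/(vpt a) -/G in za.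
have d0 : complex.Re (dTn 0 a%:C) != 0.
  by rewrite -(inj_eq (@complexI R)) -djost_real; exact: jost0_simple.
have -> : G * (complex.Re (Afun n (Num.sqrt a)%:C + Afun n (- (Num.sqrt a)%:C)) / 2 *
   (a * \prod_(b <- l | b != a) (a - b))^-1) =
   G / 2 * (complex.Re (Afun n (Num.sqrt a)%:C) * (a * \prod_(b <- l | b != a) (a - b))^-1
    + complex.Re (Afun n (- (Num.sqrt a)%:C)) * (a * \prod_(b <- l | b != a) (a - b))^-1).
  by rewrite ReD; ring.
rewrite ra rb /mass.
by apply: residue_mass_cancel => //; rewrite gt_eqF.
Qed.

End SpectralFunctional.
End SpectralMeasure.

Lemma prod_gtil (R : realType) (q alpha beta : R) n :
  \prod_(j < n) gtil alpha beta q j = qpoch alpha q n / qpoch beta q n.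
Proof. by rewrite /qpoch -prodfV -big_split. Qed.

Lemma psiplus_m1_zero (R : realType) (q alpha beta z : R) :
  0 < q < 1 -> -1 < alpha < 1 -> 0 < z < 1 ->
  psiplus alpha beta q (-1) z = 0 <-> jost q alpha beta 0 (z ^+ 2)%:C = 0.
Proof.
move=> q01 al1 /andP[z0 z1]; have z01 : 0 < z <= 1 by rewrite z0 ltW.
rewrite (psiplusE beta q01 al1 z01 (N := 0)) //; split.
  move=> /eqP; rewrite mulf_eq0 expfz_eq0 (gt_eqF z0) andbF orFb => /eqP e.
  by rewrite jost_real e.
by move=> ->; rewrite mulr0.
Qed.

Theorem theorem2p14 (R : realType) (q alpha beta : R) :
  0 < q < 1 -> -1 < alpha < 1 -> beta < 1 ->
  forall m n : nat,
  exists zs : seq R,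
    uniq zs /\
    (forall z : R, z \in zs <-> (0 < z < 1 /\ psiplus alpha beta q (-1) z = 0)) /\
    2 / pi * Rintegral lebesgue_measure `[0, pi]%classic
      (fun theta : R =>
         (pAB alpha beta q m).[2 * cos theta] * (pAB alpha beta q n).[2 * cos theta]
         * sin theta ^+ 2 / csqabs (phi21 alpha beta q theta))
    + \sum_(z <- zs)
        ((z ^+ 2 - 1) / z ^+ 2
         * (psiplus alpha beta q 0 z / derive1 (psiplus alpha beta q (-1)) z)
         * ((pAB alpha beta q m).[z + z^-1] * (pAB alpha beta q n).[z + z^-1]
            + (pAB alpha beta q m).[- (z + z^-1)] * (pAB alpha beta q n).[- (z + z^-1)]))
    = qpoch alpha q n * qpoch alpha q n.+1 / (qpoch beta q n * qpoch beta q n.+1)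
      * (m == n)%:R.
Proof.
move=> q01 al1 be1 m n.
have [l [Q [ul hl [dQ sQ] hQ1 hQ2]]] := jost_factorization q01 al1 be1.
have sq a : a \in l -> [/\ 0 < Num.sqrt a < 1, Num.sqrt a ^+ 2 = a & jost q alpha beta 0 a%:C = 0].
  move=> /hl [/andP[a0 a1] Ta]; split => //.
    by rewrite sqrtr_gt0 a0 -(sqrtr1 R) ltr_sqrt.
  by rewrite sqr_sqrtr // ltW.
(* The list l holds the zeros in w = z^2; positive square roots are the zeros in z. *)
exists (map Num.sqrt l); split; [|split].
- rewrite map_inj_in_uniq // => a b /sq [_ ea _] /sq [_ eb _] e.
  by rewrite -ea -eb e.
- move=> z; split.
    move=> /mapP[a /sq [s01 s2 Ta] ->]; split => //.
    by apply/(psiplus_m1_zero beta q01 al1 s01); rewrite s2.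
  move=> [z01 /(psiplus_m1_zero beta q01 al1 z01) Tz]; apply/mapP; exists (z ^+ 2).
    apply/hl; split => //; case/andP: z01 => z0 z1.
    by rewrite exprn_gt0 //= exprn_ilt1 // ltW.
  by rewrite sqrtr_sqr gtr0_norm //; case/andP: z01.
have eI : I0 (fun t => (pAB alpha beta q m).[2 * cos t] * (pAB alpha beta q n).[2 * cos t]
     * sin t ^+ 2 / csqabs (phi21 alpha beta q t)) =
   I0 (fun t => (pAB alpha beta q m * pAB alpha beta q n).[2 * cos t]
     * (complex.Re (Kfun q alpha beta l Q 0 t) / 2)).
  apply: I0_eq_oo => [|t t0]; first exact: Lfun_integrand_continuous.
  rewrite -(weight0 q01 al1 be1 hl hQ1 t0) hornerM; exact: esym (mulrA _ _ _).
have := favard_orthogonality (pAB0 q alpha beta) (pAB1 q alpha beta) (pABS q alpha beta)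
  (LfunD q01 al1 hl dQ) (LfunZ q01 al1 hl dQ)
  (Lfun_pAB q01 al1 be1 ul hl dQ sQ hQ1 hQ2) m n.
rewrite !prod_gtil mulf_div => <-; rewrite /Lfun -eI; congr (_ * _ + _).
rewrite big_map big_seq [RHS]big_seq; apply: eq_bigr => a al.
have [s01 s2 Ta] := sq a al; have /andP[s0 s1] := s01.
have s01' : 0 < Num.sqrt a <= 1 by rewrite s0 ltW.
have [M hM] := tc_bound q01 beta al1.
rewrite !hornerM -/(vpt a) s2 (psiplusE beta q01 al1 s01' (N := 1)) // s2 expr0z mul1r.
rewrite (derive1_zero (hM 0%N) s01) ?s2 //.
move=> x /andP[x0 x1]; have x01 : 0 < x <= 1 by rewrite x0 ltW.
by rewrite (psiplusE beta q01 al1 x01 (N := 0)).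
Qed.
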